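(* Let $\mathcal{T}$, $h\in H$, $\emptyset\ne\mathcal{I}\subset\mathcal{V}$ and $\mathcal{T}\setminus\mathcal{I}=\bigcup_i\mathcal{T}_i$ be as in the context. There is $N$ such that for every $l'_0=\sum_{v\in\mathcal{V}}a_vE_v^*\in L'$ with $[l'_0]=h$ and $a_v\ge N$ for all $v$, $$Q^{\mathcal{T}}_{[l'_0]}(l'_0)=Q^{\mathcal{T}}_{[l'_0],\mathcal{I}}(l'_0)+\sum_i Q^{\mathcal{T}_i}_{[j_i^*(l'_0)]}\big(j_i^*(l'_0)\big).$$
   Context: $\mathcal{T}$ is a connected plumbing graph which is a tree with all genus decorations $0$ and negative definite intersection matrix; $\mathcal{V}$ its vertex set, $\delta_v$ the valency. $L=\mathbb{Z}\langle E_v\rangle_{v\in\mathcal{V}}$ with the intersection form $(\,,\,)$, $L'=\{l'\in L\otimes\mathbb{Q}:(l',L)\subset\mathbb{Z}\}$ with basis $E_v^*$, $(E_v^*,E_w)=-\delta_{vw}$; $H=L'/L$, $[x]$ is the class of $x$. For $x=\sum x_vE_v$, $x|_{\mathcal{I}}=\sum_{v\in\mathcal{I}}x_vE_v$; $\ge$ is the coordinatewise order. $Z(\mathbf{t})=\sum_{l'}z^{\mathcal{T}}(l')\mathbf{t}^{l'}$ is the Taylor expansion of $\prod_v(1-\mathbf{t}^{E_v^*})^{\delta_v-2}$ ($\mathbf{t}^{l'}=\prod t_v^{l'_v}$). Counting functions: for $x\in L'$ with $[x]=h$, $Q^{\mathcal{T}}_h(x)=\sum_{l'\not\ge x,[l']=h}z^{\mathcal{T}}(l')$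 and $Q^{\mathcal{T}}_{h,\mathcal{I}}(x)=\sum_{l'|_{\mathcal{I}}\not\ge x|_{\mathcal{I}},[l']=h}z^{\mathcal{T}}(l')$ (finite sums). The $\mathcal{T}_i$ are the connected components of the full subgraph on $\mathcal{V}\setminus\mathcal{I}$; $Q^{\mathcal{T}_i}$ denotes the counting function defined analogously for $\mathcal{T}_i$ with its own lattices and series; $j_i^*:L'(\mathcal{T})\to L'(\mathcal{T}_i)$ is linear with $j_i^*(E_v^* )=E_v^*(\mathcal{T}_i)$ if $v\in\mathcal{V}(\mathcal{T}_i)$ and $0$ otherwise. *)

(* Defs.v *)
From HB Require Import structures.
From mathcomp Require Import all_boot all_order all_algebra.
Set Implicit Arguments. Unset Strict Implicit. Unset Printing Implicit Defensive.
Import Order.TTheory GRing.Theory Num.Theory.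
Local Open Scope ring_scope.

(* Plumbing graph on the vertex set 'I_n : adjacency relation [adj] and
   Euler numbers (self-intersections) [e]; all genera are 0. *)

Definition imx (n : nat) (adj : rel 'I_n) (e : 'I_n -> int) : 'M[rat]_n :=
  \matrix_(i, j) (if i == j then (e i)%:~R else if adj i j then 1 else 0).

Definition valency (n : nat) (adj : rel 'I_n) (v : 'I_n) : nat :=
  #|[set w | adj v w]|.

Definition is_tree (n : nat) (adj : rel 'I_n) : Prop :=
  [/\ (forall u v, adj u v = adj v u),
      (forall v, ~~ adj v v),
      (forall u v, connect adj u v) &
      #|[set p : 'I_n * 'I_n | adj p.1 p.2]| = (n.-1).*2 ]%N.

Definition neg_def (n : nat) (M : 'M[rat]_n) : Prop :=
  forall x : 'cV[rat]_n, x != 0 -> (x^T *m M *m x) 0 0 < 0.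

(* Elements of L' are encoded by their coordinates a in the basis E_v^* :
   l' = \sum_v a_v E_v^*.  [ecoord] gives the coordinates in the basis E_v
   (elements of L (x) Q): since (l', E_w) = - a_w, they are - M^{-1} a. *)
Definition ecoord (n : nat) (adj : rel 'I_n) (e : 'I_n -> int)
  (a : {ffun 'I_n -> int}) : 'cV[rat]_n :=
  - (invmx (imx adj e) *m \col_i ((a i)%:~R : rat)).

(* [a] = [b] in H = L'/L : the difference lies in L (integral E-coordinates) *)
Definition sameclass (n : nat) (adj : rel 'I_n) (e : 'I_n -> int)
  (a b : {ffun 'I_n -> int}) : bool :=
  [forall i, (ecoord adj e a - ecoord adj e b) i 0 \is a Num.int].

Definition gbinom (m : int) (k : nat) : rat :=
  (\prod_(i < k) ((m%:~R : rat) - i%:R)) / (k`!)%:R.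

(* coefficient of x^k in the Taylor expansion of (1 - x)^m *)
Definition sercoef (m : int) (k : nat) : rat := (-1) ^+ k * gbinom m k.

(* z(l') : coefficient of t^{l'} in prod_v (1 - t^{E_v^*})^(delta_v - 2).
   Since the E_v^* form a basis, t^{l'} only arises from the product of the
   monomials t^{a_v E_v^*}, where a are the E^*-coordinates of l'. *)
Definition zcoef (n : nat) (adj : rel 'I_n) (a : {ffun 'I_n -> int}) : rat :=
  if [forall v, 0 <= a v] then
    \prod_v sercoef ((valency adj v)%:Z - 2) `|a v|%N
  else 0.

(* summand of Q_{[x], P}(x) :  z(l') if [l'] = [x] and l'|_P not >= x|_P.
   With P = setT this is the summand of Q_{[x]}(x). *)
Definition Qterm (n : nat) (adj : rel 'I_n) (e : 'I_n -> int) (P : {set 'I_n})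
  (x : {ffun 'I_n -> int}) (a : {ffun 'I_n -> int}) : rat :=
  if sameclass adj e a x &&
     ~~ [forall v in P, ecoord adj e x v 0 <= ecoord adj e a v 0]
  then zcoef adj a else 0.

Definition has_fsum (T : eqType) (f : T -> rat) (s : rat) : Prop :=
  exists r : seq T, [/\ uniq r, (forall t, f t != 0 -> t \in r) &
                        s = \sum_(t <- r) f t].

Definition comps (n : nat) (adj : rel 'I_n) (I : {set 'I_n}) : {set {set 'I_n}} :=
  [set [set w | connect [rel u w | [&& u \notin I, w \notin I & adj u w]] v w]
  | v in ~: I].

Definition sub_adj (n : nat) (adj : rel 'I_n) (C : {set 'I_n}) : rel 'I_#|C| :=
  fun i j => adj (enum_val i) (enum_val j).
Definition sub_e (n : nat) (e : 'I_n -> int) (C : {set 'I_n}) : 'I_#|C| -> int :=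
  fun i => e (enum_val i).

(* j^* : L'(T) -> L'(T_C), E_v^* |-> E_v^*(T_C) for v in C, 0 otherwise;
   in E^*-coordinates this is restriction of the coordinates to C. *)
Definition jstar (n : nat) (C : {set 'I_n}) (a : {ffun 'I_n -> int})
  : {ffun 'I_#|C| -> int} := [ffun i => a (enum_val i)].
Arguments sub_adj {n} adj C.
Arguments sub_e {n} e C.
Arguments jstar {n} C a.

(* Main.v *)
Require Import Defs.
From HB Require Import structures.
From Stdlib Require Import ClassicalEpsilon FunctionalExtensionality.
From mathcomp Require Import all_boot all_order all_algebra.
From mathcomp Require Import zify ring lra.
Set Implicit Arguments. Unset Strict Implicit. Unset Printing Implicit Defensive.
Import Order.TTheory GRing.Theory Num.Theory.
Local Open Scope ring_scope.

(* Write [l' = l'_0 + y] with [y] integral: [z(l')] is a product over the vertices of coefficients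
   of [(1 - x)^(deg - 2)], that is, of [(1 - x)^(-2)] times one factor [1 - x] per incident edge.
   Fix [y r = k] at a vertex [r].  Each branch at [r] becomes a series in the value of [y] next to
   [r], which its edge factor turns into a Laurent polynomial [P] with [P(1) = 1]; summing over
   the branches gives the coefficient of [x^M] in [prod P / (1 - x)^2], with
   [M = - (l'_0, E_r) - k (E_r, E_r)].  Negative definiteness, through the Schur complement at
   [r], bounds the degree of [prod P] by [M] for all [k >= 0] once [l'_0] is deep enough, and then
   the coefficient is [M + 1 - sum P'(1)].  Imposing a sign condition on [y] in the branches keeps
   [P(1) = 1], so the change in the contribution of [k] is a sum over the branches; each summand
   is a difference of counting functions of the branch that telescopes over [k >= 0].  This settles
   [I = {r}] for every sign condition on the branches; the general case is the difference of two
   such identities, by induction on the tree. *)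

(** * Finitely supported sums *)

Definition listable (T : eqType) (P : T -> Prop) : Prop :=
  exists r : seq T, forall t, P t -> t \in r.

Definition fsupp (T : eqType) (f : T -> rat) : Prop := listable (fun t => f t != 0).

(* Junk value: [fsum f] is unspecified when the support of [f] is infinite. *)
Definition fsum (T : eqType) (f : T -> rat) : rat :=
  epsilon (inhabits 0) (has_fsum f).

Lemma listable_sub (T : eqType) (P P' : T -> Prop) :
  (forall t, P' t -> P t) -> listable P -> listable P'.
Proof. by move=> PP' [r Pr]; exists r => t /PP' /Pr. Qed.

(** A preimage in [P] is chosen for every element of the finite type; injectivity on [P] forces the
    one chosen for [f t] to be [t]. *)
Lemma listable_inj (T : eqType) (F : finType) (t0 : T) (P : T -> Prop) (f : T -> F) :
  (forall s t, P s -> P t -> f s = f t -> s = t) -> listable P.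
Proof.
move=> f_inj; pose g z := epsilon (inhabits t0) (fun t => P t /\ f t = z).
exists (map g (enum F)) => t Pt.
have [Pg fg] : P (g (f t)) /\ f (g (f t)) = f t.
  exact: (epsilon_spec (inhabits t0) (fun s => P s /\ f s = f t)
    (ex_intro _ t (conj Pt erefl))).
by rewrite -(f_inj _ _ Pg Pt fg) map_f ?mem_enum.
Qed.

Lemma listable_ex (T : eqType) (J : finType) (P : J -> T -> Prop) :
  (forall j, listable (P j)) -> listable (fun t => exists j, P j t).
Proof.
move=> listP.
suff [r Hr] : exists r : seq T, forall j, j \in enum J -> forall t, P j t -> t \in r.
  by exists r => t [j]; apply: Hr; rewrite mem_enum.
elim: (enum J) => [|j s [r Hr]]; first by exists [::].
have [r' Hr'] := listP j; exists (r' ++ r) => i; rewrite inE => /orP[/eqP->|/Hr Hi] t Pt.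
  by rewrite mem_cat Hr'.
by rewrite mem_cat (Hi t Pt) orbT.
Qed.

Lemma sum_support (T : eqType) (f : T -> rat) (r s : seq T) :
  uniq r -> uniq s -> {subset s <= r} -> (forall t, f t != 0 -> t \in s) ->
  \sum_(t <- r) f t = \sum_(t <- s) f t.
Proof.
move=> Ur Us sr fs; rewrite (bigID (mem s)) /= [X in _ + X]big1 ?addr0.
  rewrite -big_filter; apply: perm_big; apply: uniq_perm; rewrite ?filter_uniq // => t.
  by rewrite mem_filter /=; case: (boolP (t \in s)) => // /sr ->.
by move=> t tNs; apply/eqP; apply: contraNT tNs => /fs.
Qed.

Lemma has_fsum_unique (T : eqType) (f : T -> rat) s1 s2 :
  has_fsum f s1 -> has_fsum f s2 -> s1 = s2.
Proof.
move=> [r1 [U1 f1 ->]] [r2 [U2 f2 ->]].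
rewrite -(@sum_support _ f (undup (r1 ++ r2)) r1) ?undup_uniq //.
  rewrite -(@sum_support _ f (undup (r1 ++ r2)) r2) ?undup_uniq //.
  by move=> t; rewrite mem_undup mem_cat orbC => ->.
by move=> t; rewrite mem_undup mem_cat => ->.
Qed.

Lemma has_fsum_fsum (T : eqType) (f : T -> rat) : fsupp f -> has_fsum f (fsum f).
Proof.
move=> [r fr]; apply: epsilon_spec; exists (\sum_(t <- undup r) f t), (undup r).
split; rewrite ?undup_uniq //.
by move=> t /fr; rewrite mem_undup.
Qed.

Lemma fsumE (T : eqType) (f : T -> rat) (s : rat) : has_fsum f s -> fsum f = s.
Proof.
move=> fs; apply: (has_fsum_unique _ fs); apply: has_fsum_fsum.
by have [r [_ fr _]] := fs; exists r.
Qed.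

Lemma fsum_seq (T : eqType) (f : T -> rat) (r : seq T) :
  uniq r -> (forall t, f t != 0 -> t \in r) -> fsum f = \sum_(t <- r) f t.
Proof. by move=> Ur fr; apply: fsumE; exists r. Qed.

(** The maps need only be inverse to each other on the supports. The list is therefore filtered to
    the support of [f] before it is mapped, as [h] may identify points outside it. *)
Lemma has_fsum_reindex (T S : eqType) (f : T -> rat) (g : S -> rat)
    (h : T -> S) (h' : S -> T) c :
  (forall t, f t != 0 -> h' (h t) = t /\ g (h t) = f t) ->
  (forall s, g s != 0 -> h (h' s) = s /\ f (h' s) = g s) ->
  has_fsum f c -> has_fsum g c.
Proof.
move=> fh gh [r [Ur fr ->]].
have memr t : t \in [seq t <- r | f t != 0] -> f t != 0 by rewrite mem_filter => /andP[].
exists (map h [seq t <- r | f t != 0]); split.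
- rewrite map_inj_in_uniq ?filter_uniq // => s t /memr /fh[hs _] /memr /fh[ht _] hst.
  by rewrite -hs -ht hst.
- move=> s gs; have [hs fs] := gh s gs.
  by rewrite -hs map_f // mem_filter fs gs fr // fs.
rewrite big_map big_filter (bigID (fun t => f t == 0)) /= big1 ?add0r; last by move=> t /eqP.
by apply: eq_bigr => t /fh[].
Qed.

Lemma fsum_reindex (T S : eqType) (f : T -> rat) (g : S -> rat)
    (h : T -> S) (h' : S -> T) :
  (forall t, f t != 0 -> h' (h t) = t /\ g (h t) = f t) ->
  (forall s, g s != 0 -> h (h' s) = s /\ f (h' s) = g s) ->
  fsupp f -> fsum f = fsum g.
Proof.
by move=> fh gh ff; apply/esym/fsumE/(has_fsum_reindex fh gh)/has_fsum_fsum.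
Qed.

Lemma fsuppW (T : eqType) (f g : T -> rat) :
  fsupp f -> (forall t, f t = 0 -> g t = 0) -> fsupp g.
Proof.
move=> Ff fg; apply: listable_sub Ff => t; apply: contra_neq; exact: fg.
Qed.

Lemma eq_fsum (T : eqType) (f g : T -> rat) : f =1 g -> fsum f = fsum g.
Proof. by move=> /functional_extensionality ->. Qed.

Lemma fsupp_op (T : eqType) (f g k : T -> rat) :
  fsupp f -> fsupp g -> (forall t, f t = 0 -> g t = 0 -> k t = 0) -> fsupp k.
Proof.
move=> [r fr] [s gs] fgk; exists (r ++ s) => t kt; rewrite mem_cat.
case: (eqVneq (f t) 0) => [f0|/fr -> //]; case: (eqVneq (g t) 0) => [g0|/gs ->].
  by rewrite fgk ?eqxx in kt.
by rewrite orbT.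
Qed.

Lemma fsuppD (T : eqType) (f g : T -> rat) :
  fsupp f -> fsupp g -> fsupp (fun t => f t + g t).
Proof. by move=> Ff Fg; apply: (fsupp_op Ff Fg) => t -> ->; rewrite addr0. Qed.

Lemma fsuppB (T : eqType) (f g : T -> rat) :
  fsupp f -> fsupp g -> fsupp (fun t => f t - g t).
Proof. by move=> Ff Fg; apply: (fsupp_op Ff Fg) => t -> ->; rewrite subr0. Qed.

Lemma common_support (T : eqType) (f g : T -> rat) : fsupp f -> fsupp g ->
  exists r, [/\ uniq r, (forall t, f t != 0 -> t \in r) & (forall t, g t != 0 -> t \in r)].
Proof.
move=> [r fr] [s gs]; exists (undup (r ++ s)); split; rewrite ?undup_uniq // => t.
  by move/fr; rewrite mem_undup mem_cat => ->.
by move/gs; rewrite mem_undup mem_cat orbC => ->.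
Qed.

Lemma fsumD (T : eqType) (f g : T -> rat) : fsupp f -> fsupp g ->
  fsum (fun t => f t + g t) = fsum f + fsum g.
Proof.
move=> Ff Fg; have [r [Ur fr gr]] := common_support Ff Fg.
rewrite (fsum_seq Ur fr) (fsum_seq Ur gr) -big_split /=; apply: fsum_seq => // t.
apply: contraTT => tr.
by rewrite (contraNeq (fr t) tr) ?(eqP (contraNT (gr t) tr)) // negbK addr0.
Qed.

Lemma fsum_mull (T : eqType) (f : T -> rat) c : fsupp f ->
  fsum (fun t => c * f t) = c * fsum f.
Proof.
move=> /has_fsum_fsum[r [Ur fr ->]]; rewrite mulr_sumr; apply: fsum_seq => // t.
by rewrite mulf_eq0 negb_or => /andP[_ /fr].
Qed.

Lemma fsumB (T : eqType) (f g : T -> rat) : fsupp f -> fsupp g ->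
  fsum (fun t => f t - g t) = fsum f - fsum g.
Proof.
move=> Ff Fg; rewrite -mulN1r -fsum_mull // -fsumD //.
  by apply: eq_fsum => t; rewrite mulN1r.
by apply: (fsuppW Fg) => t ->; rewrite mulr0.
Qed.

Lemma fsum_sum (T J : eqType) (s : seq J) (f : J -> T -> rat) :
  (forall j, j \in s -> fsupp (f j)) ->
  fsupp (fun t => \sum_(j <- s) f j t) /\
  fsum (fun t => \sum_(j <- s) f j t) = \sum_(j <- s) fsum (f j).
Proof.
elim: s => [|j s IHs] Ff.
  split; first by exists [::] => t; rewrite big_nil eqxx.
  by rewrite big_nil (@fsum_seq _ _ [::]) ?big_nil // => t; rewrite big_nil eqxx.
have E t : \sum_(i <- j :: s) f i t = f j t + \sum_(i <- s) f i t by rewrite big_cons.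
have [|IHf {}IHs] := IHs; first by move=> i si; apply: Ff; rewrite inE si orbT.
have Fj : fsupp (f j) by apply: Ff; rewrite inE eqxx.
rewrite (functional_extensionality _ _ E) big_cons -IHs -fsumD //.
by split=> //; apply: fsuppD.
Qed.

Lemma fsum0 (T : eqType) (f : T -> rat) : (forall t, f t = 0) -> fsum f = 0.
Proof.
by move=> f0; rewrite (@fsum_seq _ f [::]) ?big_nil // => t; rewrite f0 eqxx.
Qed.

Lemma fsum_pair (T S : eqType) (f : T * S -> rat) : fsupp f ->
  fsum f = fsum (fun t => fsum (fun s => f (t, s))).
Proof.
move=> [r fr].
pose r1 := undup (unzip1 r); pose r2 := undup (unzip2 r).
have fr1 t s : f (t, s) != 0 -> t \in r1.
  by move/fr => ts; rewrite mem_undup; apply/mapP; exists (t, s).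
have fr2 t s : f (t, s) != 0 -> s \in r2.
  by move/fr => ts; rewrite mem_undup; apply/mapP; exists (t, s).
have -> : fsum f = \sum_(p <- [seq (t, s) | t <- r1, s <- r2]) f p.
  apply: fsum_seq; first by rewrite allpairs_uniq ?undup_uniq // => -[? ?] [? ?].
  by move=> [t s] fts; apply: allpairs_f; [apply: fr1 fts|apply: fr2 fts].
have inE t : fsum (fun s => f (t, s)) = \sum_(s <- r2) f (t, s).
  by apply: fsum_seq; rewrite ?undup_uniq // => s; apply: fr2.
rewrite big_allpairs_dep /= (eq_fsum inE); apply/esym/fsum_seq; rewrite ?undup_uniq // => t.
apply: contraNT => tr; rewrite big1 // => s _; apply/eqP.
by apply: contraNT tr => /fr1.
Qed.

Lemma fsum_mul (T S : eqType) (f : T -> rat) (g : S -> rat) : fsupp f -> fsupp g ->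
  fsum (fun p : T * S => f p.1 * g p.2) = fsum f * fsum g.
Proof.
move=> Ff Fg; rewrite fsum_pair /=.
  rewrite mulrC -fsum_mull //; apply: eq_fsum => t; rewrite fsum_mull //; exact: mulrC.
have [r fr] := Ff; have [s gs] := Fg; exists [seq (t, u) | t <- r, u <- s] => -[t u] /=.
by rewrite mulf_eq0 negb_or => /andP[/fr ? /gs ?]; apply: allpairs_f.
Qed.

(** Fubini for [f] placed on the graph of [h] and extended by zero to all pairs. *)
Lemma fsum_fiber (T S : eqType) (f : T -> rat) (h : T -> S) : fsupp f ->
  fsum f = fsum (fun s => fsum (fun t => if h t == s then f t else 0)).
Proof.
move=> Ff; pose g (p : S * T) := if h p.2 == p.1 then f p.2 else 0.
rewrite -(@fsum_pair _ _ g).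
  apply: (@fsum_reindex _ _ f g (fun t => (h t, t)) snd) => // [t _|[s t]] /=.
    by rewrite /g eqxx.

  by rewrite /g /=; case: (h t =P s) => [<-|]; rewrite ?eqxx.
have [r fr] := Ff; exists (map (fun t => (h t, t)) r) => -[s t]; rewrite /g /=.
by case: (h t =P s) => [<- /fr tr|]; rewrite ?eqxx // (map_f (fun t => (h t, t))).
Qed.

Lemma fsupp_fiber (T S : eqType) (f : T -> rat) (h : T -> S) : fsupp f ->
  fsupp (fun s => fsum (fun t => if h t == s then f t else 0)).
Proof.
move=> [r fr]; exists (map h r) => s; apply: contraNT => hs; apply/eqP/fsum0 => t.
case: eqP => // hts; apply/eqP; apply: contraNT hs => /fr tr.
by rewrite -hts map_f.
Qed.

(** * Coefficient sequences of Laurent series *)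

Definition lowsupp (f : int -> rat) : Prop := exists L, forall t, t <= L -> f t = 0.

(** The coefficients of [F / (1 - x)], with [F] a Laurent polynomial of degree at most [D] and
    [F(1) = 1]. *)
Definition isstep (f : int -> rat) (D : int) : Prop :=
  lowsupp f /\ forall t, D <= t -> f t = 1.

Lemma fsupp_int (f : int -> rat) L U :
  (forall t, t <= L -> f t = 0) -> (forall t, U <= t -> f t = 0) -> fsupp f.
Proof.
move=> fL fU; exists [seq L + (i%:Z) | i <- iota 0 `|U - L|] => t ft.
have Lt : L < t by rewrite ltNge; apply: contraNN ft => /fL ->.
have tU : t < U by rewrite ltNge; apply: contraNN ft => /fU ->.
apply/mapP; exists `|t - L|%N; last lia.
rewrite mem_iota; lia.
Qed.

Lemma fsum_telescope (f : int -> rat) (U : int) (c : rat) :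
  lowsupp f -> (forall t, U <= t -> f t = c) ->
  fsupp (fun t => f t - f (t - 1)) /\ fsum (fun t => f t - f (t - 1)) = c.
Proof.
move=> [L fL] fU.
have Ff : fsupp (fun t => f t - f (t - 1)).
  apply: (@fsupp_int _ L (U + 1)) => t Ht; last by rewrite !fU ?subrr //; lia.
  by rewrite !fL ?subrr //; lia.
(* The absolute value also serves when [U < L]: in either case [L + m] is at least [U]. *)
split=> //; pose m := `|U - L|%N.
rewrite (@fsum_seq _ _ [seq L + i%:Z | i <- iota 1 m]).
- have -> : \sum_(t <- [seq L + i%:Z | i <- iota 1 m]) (f t - f (t - 1)) =
      \sum_(1 <= i < m.+1) (f (L + i%:Z) - f (L + (i.-1)%:Z)).
    rewrite big_map /index_iota subn1 big_seq [RHS]big_seq; apply: eq_bigr => i.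
    by rewrite mem_iota => /andP[i_gt0 _]; congr (f _ - f _); lia.
  rewrite (@telescope_sumr_eq _ _ _ (fun i : nat => f (L + (i.-1)%:Z))) //=.
  rewrite addr0 (fL L) // subr0.
  have [le_LU|lt_UL] := leP L U; first by rewrite fU //; lia.
  by rewrite fU //; lia.
- by rewrite map_inj_uniq ?iota_uniq // => i j; lia.
move=> t ft; have Lt : L < t.
  rewrite ltNge; apply: contraNN ft => Ht; rewrite !fL ?subrr //; lia.
have tU : t <= U.
  rewrite leNgt; apply: contraNN ft => Ht; rewrite !fU ?subrr //; lia.
apply/mapP; exists `|t - L|%N; last lia.
rewrite mem_iota; lia.
Qed.

Lemma fsum_int_opp (f : int -> rat) (N : int) : fsupp f ->
  fsupp (fun t => f (N - t)) /\ fsum (fun t => f (N - t)) = fsum f.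
Proof.
move=> Ff; split; last first.
  by apply/esym/(@fsum_reindex _ _ _ _ (fun t => N - t) (fun t => N - t)) => // t _; rewrite subKr.
have [r fr] := Ff; exists (map (fun t => N - t) r) => t /fr.
by move/(map_f (fun t => N - t)); rewrite subKr.
Qed.

(* Convolving the series [f = F / (1 - x)] and [g = G / (1 - x)], with [F] and [G] Laurent
   polynomials of value 1 at 1, against [1 - x] gives [F * G / (1 - x)]. *)
Lemma isstep_conv (f g : int -> rat) (D1 D2 N : int) :
  isstep f D1 -> isstep g D2 -> D1 + D2 <= N ->
  fsum (fun t => f t * (g (N - t) - g (N - t - 1))) = 1.
Proof.
move=> [_ f1] [lg g1] leN.
have [Fg Sg] := fsum_telescope lg g1; have [_ SN] := fsum_int_opp N Fg.
rewrite -[RHS]Sg -[RHS]SN; apply: eq_fsum => t.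
(* Below [D1], where [f] need not be 1, [N - t - 1] is at least [D2] and the difference of [g]
   vanishes; so [f] can be replaced by 1 throughout. *)
have [/f1 ->|lt_tD] := leP D1 t; first by rewrite mul1r.
by rewrite !g1 ?subrr ?mulr0 //; lia.
Qed.

(* With [f = F / (1 - x)] and so on, the left side is the coefficient of [x^N] in
   [(F G - F' G') / (1 - x)^2], in the range where it only depends on the derivative at 1. *)
Lemma isstep_conv_diff (f g f' g' : int -> rat) (D1 D2 N : int) :
  isstep f D1 -> isstep g D2 -> isstep f' D1 -> isstep g' D2 -> D1 + D2 <= N ->
  fsum (fun t => f t * g (N - t) - f' t * g' (N - t)) =
  fsum (fun t => f t - f' t) + fsum (fun t => g t - g' t).
Proof.
move=> [[L1 lf] f1] [[L2 lg] g1] [[L3 lf'] f1'] [[L4 lg'] g1'] leN.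
have Ff : fsupp (fun t => f t - f' t).
  apply: (@fsupp_int _ (Num.min L1 L3) D1) => t; last by move=> Ht; rewrite f1 // f1' // subrr.
  by rewrite le_min => /andP[? ?]; rewrite lf // lf' // subrr.
have Fg : fsupp (fun t => g t - g' t).
  apply: (@fsupp_int _ (Num.min L2 L4) D2) => t; last by move=> Ht; rewrite g1 // g1' // subrr.
  by rewrite le_min => /andP[? ?]; rewrite lg // lg' // subrr.
have [FN SN] := fsum_int_opp N Fg; rewrite -SN -fsumD //; apply: eq_fsum => t /=.
(* For [t >= D1] both [f] and [f'] are 1; for [t < D1] both [g] and [g'] are 1 at [N - t]. Either
   way one of the two differences is zero and the other is the summand. *)
have [Ht|Ht] := leP D1 t; first by rewrite f1 // f1' //; ring.
by rewrite (g1 (N - t)) 1?(g1' (N - t)); [ring|lia|lia].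
Qed.

Lemma lowsupp_sub (f g : int -> rat) : lowsupp f -> lowsupp g -> lowsupp (fun t => f t - g t).
Proof.
move=> [L fL] [M gM]; exists (Num.min L M) => t; rewrite le_min => /andP[tL tM].
by rewrite fL // gM // subrr.
Qed.

Lemma lowsupp_diff (f : int -> rat) : lowsupp f -> lowsupp (fun t => f t - f (t - 1)).
Proof.
move=> lf; have [L fL] := lf; apply: lowsupp_sub => //; exists L => t tL.
by rewrite fL //; lia.
Qed.

Lemma fsupp_conv (f g : int -> rat) (N : int) : lowsupp f -> lowsupp g ->
  fsupp (fun t => f t * g (N - t)).
Proof.
move=> [L fL] [M gM]; apply: (@fsupp_int _ L (N - M)) => t Ht; first by rewrite fL // mul0r.
by rewrite gM ?mulr0 //; lia.
Qed.

(** Freezing [F] above [N] makes its differences vanish where [k < 0], so the one-sided sum becomes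
    a telescoping sum over all integers. *)
Lemma fsum_tail (F : int -> rat) (N : int) : lowsupp F ->
  fsupp (fun k => if 0 <= k then F (N - k) - F (N - k - 1) else 0) /\
  fsum (fun k => if 0 <= k then F (N - k) - F (N - k - 1) else 0) = F N.
Proof.
move=> [L FL]; pose F' t := F (Num.min t N).
have lF' : lowsupp F'.
  by exists L => t tL; rewrite /F' FL // ge_min tL.
have F'N t : N <= t -> F' t = F N by move=> Nt; rewrite /F' min_r.
have [fF sF] := fsum_telescope lF' F'N; have [fN sN] := fsum_int_opp N fF.
have E k : F' (N - k) - F' (N - k - 1) = if 0 <= k then F (N - k) - F (N - k - 1) else 0.
  case: leP => [k0|k0]; first by rewrite /F' !min_l //; lia.
  by rewrite !F'N ?subrr //; lia.
by rewrite -(functional_extensionality _ _ E) sN.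
Qed.

(** * Trees and components *)

Lemma card_disjointU (T : finType) (A B : {set T}) :
  [disjoint A & B] -> #|A :|: B| = (#|A| + #|B|)%N.
Proof. by rewrite -setI_eq0 -cardsUI => /eqP ->; rewrite cards0 addn0. Qed.

Section Trees.
Variables (n : nat) (adj : rel 'I_n).
Hypotheses (adj_sym : symmetric adj) (adj_irr : irreflexive adj).
Implicit Types (A B C X : {set 'I_n}) (r u v w : 'I_n).

Definition joined A B r u : Prop :=
  [/\ r \in A, u \in B, [disjoint A & B], adj r u
    & forall v w, v \in A -> w \in B -> adj v w -> v = r /\ w = u].

(** Trees are generated by gluing along single edges, because the weights below factor along such a
    gluing. *)
Inductive utree : {set 'I_n} -> Prop :=
| utree1 r : utree [set r]
| utreeU A B r u : joined A B r u -> utree A -> utree B -> utree (A :|: B).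

Lemma joinedC A B r u : joined A B r u -> joined B A u r.
Proof.
move=> [rA uB dAB ru AB]; split=> //; rewrite 1?disjoint_sym 1?adj_sym //.
by move=> v w vB wA; rewrite adj_sym => /(AB _ _ wA vB)[-> ->].
Qed.

(** The splitting edge can be chosen at any given vertex [r]: if the last gluing edge [a b] is
    elsewhere, the half containing [r] is split at [r] by induction, and the other half is glued
    back to the piece that contains [a]. *)
Lemma utree_split C r : utree C -> r \in C ->
  C = [set r] \/ exists A B u, [/\ C = A :|: B, joined A B r u, utree A & utree B].
Proof.
move=> tC; elim: tC r => [s|A B a b jAB tA IHA tB IHB] r; first by rewrite inE => /eqP->; left.
wlog rA : A B a b jAB tA tB IHA IHB / r \in A.
  move=> WH rAB; move: (rAB); rewrite inE => /orP[rA|rB]; first exact: (WH A B a b).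
  by rewrite setUC; apply: (WH B A b a) => //; [apply: joinedC|rewrite setUC].
move=> _; right; have [aA bB dAB ab AB] := jAB.
have [->|ne_ra] := eqVneq r a; first by exists A, B, b.
case: (IHA _ rA) => [eqA|[A1 [A2 [u [eqA jA tA1 tA2]]]]].
  by move: aA; rewrite eqA inE eq_sym (negPf ne_ra).
have [rA1 uA2 dA ru A12] := jA.
move: dAB; rewrite eqA disjoints_subset subUset -!disjoints_subset => /andP[d1 d2].
have AB' v w : v \in A1 :|: A2 -> w \in B -> adj v w -> v = a /\ w = b.
  by rewrite -eqA; apply: AB.
move: aA; rewrite eqA inE => /orP[aA1|aA2].
  exists (A1 :|: B), A2, u; split=> //; first by rewrite setUAC.
    split=> //; first by rewrite inE rA1.
      by rewrite disjoints_subset subUset -!disjoints_subset dA disjoint_sym.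
    move=> v w; rewrite inE => /orP[vA1|vB]; first exact: A12.
    move=> wA2; rewrite adj_sym => /AB'[] //; first by rewrite inE wA2 orbT.
    by move=> wa; move: (disjointFr dA aA1); rewrite -wa wA2.
  apply: (@utreeU _ _ a b) => //; split=> // v w vA1; apply: AB'.
  by rewrite inE vA1.
exists A1, (A2 :|: B), u; split=> //; first by rewrite setUA.
  split=> //; first by rewrite inE uA2.
    by rewrite disjoint_sym disjoints_subset subUset -!disjoints_subset;
      rewrite ![[disjoint _ & A1]]disjoint_sym dA.
  move=> v w vA1; rewrite inE => /orP[wA2|wB]; first exact: A12.
  move=> /AB'[] //; first by rewrite inE vA1.
  by move=> va; move: (disjointFr dA vA1); rewrite va aA2.
apply: (@utreeU _ _ a b) => //; split=> // v w vA2; apply: AB'.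
by rewrite inE vA2 orbT.
Qed.

Lemma joined_card A B r u : joined A B r u -> #|A :|: B| = (#|A| + #|B|)%N.
Proof. by case=> _ _ dAB _ _; apply: card_disjointU. Qed.

(** A branch [B] with root [u] is peeled off at the root [r], which stays the root of the rest. The
    induction is on cardinality, since this splitting need not be the one that generated [C]. *)
Lemma utree_rooted_ind (P : {set 'I_n} -> 'I_n -> Prop) :
  (forall r, P [set r] r) ->
  (forall A B r u, joined A B r u -> utree A -> utree B -> P A r -> P B u ->
     P (A :|: B) r) ->
  forall C r, utree C -> r \in C -> P C r.
Proof.
move=> P1 PU C; move: {2}#|C|.+1 (ltnSn #|C|) => m; elim: m C => // m IHm C leC r tC rC.
case: (utree_split tC rC) => [->//|[A [B [u [eqC jAB tA tB]]]]].
have [rA uB _ _ _] := jAB.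
have cA : (0 < #|A|)%N by rewrite card_gt0; apply/set0Pn; exists r.
have cB : (0 < #|B|)%N by rewrite card_gt0; apply/set0Pn; exists u.
move: leC; rewrite eqC (joined_card jAB) => leC.
by apply: (PU _ _ _ u) => //; apply: IHm => //; lia.
Qed.

Definition deg C v : nat := #|[set w in C | adj v w]|.

Lemma deg1 r : deg [set r] r = 0%N.
Proof.
apply/eqP; rewrite cards_eq0; apply/eqP/setP => w; rewrite !inE.
by case: eqP => // ->; rewrite adj_irr.
Qed.

Lemma joined_deg A B r u v : joined A B r u -> v \in A ->
  deg (A :|: B) v = (deg A v + (v == r))%N.
Proof.
case=> [rA uB dAB ru AB] vA; rewrite /deg.
have -> : [set w in A :|: B | adj v w] =
    [set w in A | adj v w] :|: [set w in B | adj v w].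
  by apply/setP => w; rewrite !inE andb_orl.
rewrite card_disjointU; last first.
  by apply: disjointWl (disjointWr _ dAB); apply/subsetP => w; rewrite inE => /andP[].
congr addn; have [->|ne_vr] := eqVneq v r.
  apply: etrans (cards1 u); apply: eq_card => w; rewrite !inE.
  by apply/andP/eqP => [[wB /AB[]]|->].
apply/eqP; rewrite cards_eq0; apply/eqP/setP => w; rewrite !inE.
by apply/negP => /andP[wB /(AB _ _ vA wB)[] /eqP]; rewrite (negPf ne_vr).
Qed.

(* Adding a vertex with [d] neighbours in [C] adds [2 d >= 2] to the degree sum, so the total of
   [2 (n - 1)] forces [d = 1] at every step of the exhaustion of the graph. *)
Lemma is_tree_utree : is_tree adj -> (0 < n)%N -> utree setT.
Proof.
case=> _ _ conn cardE n_gt0.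
pose E C := #|[set p : 'I_n * 'I_n | [&& p.1 \in C, p.2 \in C & adj p.1 p.2]]|.
have ET : E setT = (n.-1).*2.
  by rewrite -cardE; apply: eq_card => p; rewrite !inE.
(* The set grown so far is known to be a tree only if its edge count, doubled in [E], is minimal;
   minimality of the final count passes down to every earlier set. *)
suff grow m : (m < n)%N -> exists C, [/\ #|C| = m.+1, (m.*2 <= E C)%N &
    E C = m.*2 -> utree C].
  have [|C [cC _ tC]] := grow n.-1; first by rewrite prednK.
  have CT : C = setT by apply/eqP; rewrite eqEcard subsetT cardsT card_ord cC prednK /=.
  by rewrite -CT; apply: tC; rewrite CT.
elim: m => [|m IHm] lt_mn.
  exists [set Ordinal n_gt0]; rewrite cards1; split=> // _; exact: utree1.
have [C [cC leE tC]] := IHm (ltnW lt_mn).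
have [v0 v0C] : exists v, v \in C by apply/set0Pn; rewrite -card_gt0 cC.
(* A set closed under adjacency is everything, by connectedness; otherwise some edge leaves [C]. *)
have [vC|[u [v [uC vC uv]]]] : (forall w, w \in C) \/
    exists u v, [/\ u \in C, v \notin C & adj u v].
- have [/forallP clC|] := boolP [forall u in C, forall v, adj u v ==> (v \in C)].
    left=> w; have := conn v0 w => /connectP[p]; elim: p v0 v0C => [|x p IHp] v vC /=.
      by move=> _ ->.
    case/andP=> vx; apply: IHp; move/implyP: (clC v) => /(_ vC)/forallP/(_ x).
    by rewrite vx.
  case/forallPn=> u; rewrite negb_imply => /andP[uC /forallPn[v]].
  by rewrite negb_imply => /andP[uv vC]; right; exists u, v.
- have CT : C = setT by apply/setP => w; rewrite vC inE.
  by move: cC; rewrite CT cardsT card_ord; lia.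
have Ev : E (v |: C) = (E C + (deg C v).*2)%N.
  pose E1 := [set p : 'I_n * 'I_n | [&& p.1 \in C, p.2 \in C & adj p.1 p.2]].
  pose E2 := [set (v, w) | w in [set w in C | adj v w]].
  pose E3 := [set (w, v) | w in [set w in C | adj v w]].
  have -> : E (v |: C) = #|E1 :|: (E2 :|: E3)|.
    apply: eq_card => -[x y]; rewrite !inE /=.
    have -> : ((x, y) \in E2) = [&& x == v, y \in C & adj v y].
      apply/imsetP/and3P => [[w]|[/eqP-> yC vy]].
        by rewrite inE => /andP[wC vw] [-> ->].
      by exists y => //; rewrite inE yC.
    have -> : ((x, y) \in E3) = [&& y == v, x \in C & adj v x].
      apply/imsetP/and3P => [[w]|[/eqP-> xC vx]].
        by rewrite inE => /andP[wC vw] [-> ->].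
      by exists x => //; rewrite inE xC.
    have [->|_] := eqVneq x v; have [->|_] := eqVneq y v;
      rewrite ?adj_irr ?(negPf vC) ?andbF ?orbF //=.
    by rewrite adj_sym.
  have c2 : #|E2| = deg C v by rewrite card_imset // => ? ? [].
  have c3 : #|E3| = deg C v by rewrite card_imset // => ? ? [].
  have d23 : [disjoint E2 & E3].
    apply/pred0P => -[x y] /=; apply/negP => /andP[/imsetP[w _ [-> _]] /imsetP[w' w'C [vw' _]]].
    by move: w'C; rewrite -vw' inE (negPf vC).
  have d1 : [disjoint E1 & E2 :|: E3].
    apply/pred0P => -[x y] /=; apply/negP; rewrite !inE => /andP[/and3P[xC yC _] /orP[]].
      by move=> /imsetP[w _ [xv _]]; move: xC; rewrite /= xv (negPf vC).
    by move=> /imsetP[w _ [_ yv]]; move: yC; rewrite /= yv (negPf vC).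
  rewrite !card_disjointU //.
  by rewrite c2 c3 addnn.
have dv : (0 < deg C v)%N.
  by rewrite card_gt0; apply/set0Pn; exists u; rewrite inE uC adj_sym.
exists (v |: C); rewrite cardsU1 vC cC Ev; split=> //; first lia.
move=> eqE; rewrite setUC; apply: (@utreeU _ _ u v); last exact: utree1; last by apply: tC; lia.
have /cards1P[x eqx] : deg C v == 1%N by lia.
split=> //; rewrite ?set11 //.
  by rewrite disjoint_sym disjoints1.
move=> x' v'; rewrite inE => x'C /eqP-> x'v; split=> //.
have ux : u \in [set w in C | adj v w] by rewrite inE uC adj_sym.
have x'x : x' \in [set w in C | adj v w] by rewrite inE x'C adj_sym.
by move: ux x'x; rewrite eqx !inE => /eqP-> /eqP->.
Qed.

(** A forest with the list of its trees. Induction on the list avoids arguing with paths until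
    [compsE] compares it with [comps]. *)
Inductive comps_of : {set 'I_n} -> seq {set 'I_n} -> Prop :=
| comps_of0 : comps_of set0 [::]
| comps_ofU D X s : utree D -> [disjoint D & X] ->
    (forall v w, v \in D -> w \in X -> ~~ adj v w) ->
    comps_of X s -> comps_of (D :|: X) (D :: s).

Lemma comps_of_cat X Y s t : comps_of X s -> comps_of Y t -> [disjoint X & Y] ->
  (forall v w, v \in X -> w \in Y -> ~~ adj v w) -> comps_of (X :|: Y) (s ++ t).
Proof.
move=> cX cY; elim: cX => [|D X' s' tD dD nD cX' IH]; first by rewrite set0U.
rewrite disjoints_subset subUset -!disjoints_subset => /andP[d1 d2] nXY.
rewrite -setUA; apply: comps_ofU => //.
- by rewrite disjoint_sym disjoints_subset subUset -!disjoints_subset;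
  rewrite ![[disjoint _ & D]]disjoint_sym dD.
- move=> v w vD; rewrite inE => /orP[wX|wY]; first exact: nD.
  by apply: nXY => //; rewrite inE vD.
by apply: IH => // v w vX; apply: nXY; rewrite inE vX orbT.
Qed.

Lemma utree_neq0 C : utree C -> exists v, v \in C.
Proof.
by elim=> [r|A B r u _ _ [v vA] _ _]; [exists r; rewrite set11|exists v; rewrite inE vA].
Qed.

Lemma utree_connect C (e : rel 'I_n) v w : utree C ->
  (forall v w, v \in C -> w \in C -> adj v w -> e v w) ->
  v \in C -> w \in C -> connect e v w.
Proof.
move=> tC; elim: tC v w => [r|A B r u [rA uB dAB ru AB] tA IHA tB IHB] v w eC.
  by rewrite !inE => /eqP-> /eqP->.
have eA x y : x \in A -> y \in A -> connect e x y.
  by apply: IHA => v' w' v'A w'A; apply: eC; rewrite inE ?v'A ?w'A.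
have eB x y : x \in B -> y \in B -> connect e x y.
  by apply: IHB => v' w' v'B w'B; apply: eC; rewrite inE ?v'B ?w'B orbT.
have ru' : connect e r u by apply/connect1/eC; rewrite // inE ?rA ?uB ?orbT.
have ur' : connect e u r by apply/connect1/eC; rewrite 1?adj_sym // inE ?rA ?uB ?orbT.
rewrite !inE => /orP[vA|vB] /orP[wA|wB]; [exact: eA|..|exact: eB].
  by apply: connect_trans (eA _ _ vA rA) (connect_trans ru' (eB _ _ uB wB)).
by apply: connect_trans (eB _ _ vB uB) (connect_trans ur' (eA _ _ rA wA)).
Qed.

Lemma comps_of_closed X s D v w : comps_of X s -> D \in s -> v \in D -> w \in X -> adj v w ->
  w \in D.
Proof.
elim=> // D' X' s' tD' dD' nD' cX' IH; rewrite inE => /orP[/eqP->|Ds'].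
  by move=> vD; rewrite inE => /orP[//|wX] vw; have := nD' v w vD wX; rewrite vw.
move=> vD; rewrite inE => /orP[wD'|]; last exact: IH.
rewrite adj_sym => wv; have := nD' w v wD'; rewrite wv => /(_ _)/negP[] //.
elim: {IH nD' dD'} cX' Ds' => // D'' X'' s'' _ _ _ _ IH.
by rewrite !inE => /orP[/eqP<-|/IH->]; rewrite ?vD ?orbT.
Qed.

Lemma comps_of_sub X s D : comps_of X s -> D \in s -> D \subset X.
Proof.
elim=> // D' X' s' tD' dD' nD' cX' IH; rewrite inE => /orP[/eqP->|/IH Ds'].
  exact: subsetUl.
exact: subset_trans Ds' (subsetUr _ _).
Qed.

Lemma comps_of_utree X s D : comps_of X s -> D \in s -> utree D.
Proof. by elim=> // D' X' s' tD' dD' nD' cX' IH; rewrite inE => /orP[/eqP->|]. Qed.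

Lemma comps_of_uniq X s : comps_of X s -> uniq s.
Proof.
elim=> //= D' X' s' tD' dD' nD' cX' ->; rewrite andbT; apply/negP => D's.
have [v vD] := utree_neq0 tD'; have /subsetP/(_ v vD) := comps_of_sub cX' D's.
by rewrite (disjointFr dD' vD).
Qed.

Lemma comps_of_cover X s v : comps_of X s -> v \in X -> exists2 D, D \in s & v \in D.
Proof.
elim=> [|D' X' s' tD' dD' nD' cX' IH]; rewrite inE // => /orP[vD|/IH[D Ds vD]].
  by exists D' => //; rewrite inE eqxx.
by exists D => //; rewrite inE Ds orbT.
Qed.

(** A path outside [I] cannot leave a member of [s], and each member, being a tree, is connected by
    such paths; so the members are the path classes. *)
Lemma compsE (I : {set 'I_n}) s : comps_of (~: I) s -> comps adj I =i s.
Proof.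
move=> cs; pose e := [rel u w | [&& u \notin I, w \notin I & adj u w]].
have compE D v : D \in s -> v \in D -> [set w | connect e v w] = D.
  move=> Ds vD; have DX := subsetP (comps_of_sub cs Ds).
  apply/setP => w; rewrite inE; apply/idP/idP => [/connectP[p]|wD]; last first.
    apply: (utree_connect (comps_of_utree cs Ds)) => // x y /DX + /DX; rewrite !inE => xI yI xy.
    by rewrite /e /= xI yI.
  elim: p v vD => [|x p IHp] v vD /=; first by move=> _ ->.
  case/andP=> /and3P[_ xI vx]; apply: IHp; apply: (comps_of_closed cs Ds vD) => //.
  by rewrite inE.
move=> D; apply/imsetP/idP => [[v vI ->]|Ds].
  by have [D' D's vD'] := comps_of_cover cs vI; rewrite -/e (compE D').
have [v vD] := utree_neq0 (comps_of_utree cs Ds); exists v; last by rewrite -/e (compE D).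
by have /subsetP/(_ v vD) := comps_of_sub cs Ds.
Qed.

End Trees.

(** * Weights and branches *)

(** The extension by zero to negative exponents lets [serS] hold without a boundary case. *)
Definition ser (m a : int) : rat := if 0 <= a then sercoef m `|a|%N else 0.

Lemma gbinomS (m : int) k : gbinom (m + 1) k.+1 = gbinom m k.+1 + gbinom m k.
Proof.
rewrite /gbinom big_ord_recl /= subr0.
have -> : \prod_(i < k) (((m + 1)%:~R : rat) - (bump 0 i)%:R) = \prod_(i < k) (m%:~R - i%:R).
  by apply: eq_bigr => i _; rewrite /bump /= natrD rmorphD /=; ring.
rewrite big_ord_recr /= factS natrM rmorphD /= -natr1; set P := \prod_(i < k) _.
have nz : (k`!)%:R != 0 :> rat by rewrite pnatr_eq0 -lt0n fact_gt0.
have kz : k%:R + 1 != 0 :> rat by rewrite natr1 pnatr_eq0.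
by field; rewrite nz kz.
Qed.

(** Multiplication of the series by [1 - x]. An edge raises the exponent [deg - 2] at each of its
    ends in this way. *)
Lemma serS (m a : int) : ser (m + 1) a = ser m a - ser m (a - 1).
Proof.
rewrite /ser; have [a_lt0|a_ge0] := ltP a 0.
  by rewrite ifF ?subr0 //; lia.
case: a a_ge0 => [[|k]|//] _; first by rewrite /sercoef /gbinom !big_ord0 subr0.
have -> : k.+1%:Z - 1 = k%:Z by lia.
by rewrite /= /sercoef gbinomS exprS; ring.
Qed.

Lemma ser_geom (a : int) : 0 <= a -> ser (-1) a = 1.
Proof.
move=> a_ge0; rewrite /ser a_ge0 /sercoef /gbinom.
have -> m : \prod_(i < m) ((-1)%:~R - i%:R : rat) = (-1) ^+ m * (m`!)%:R.
  elim: m => [|m IHm]; first by rewrite big_ord0 mulr1.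
  rewrite big_ord_recr IHm factS natrM exprS -[m.+1%:R]natr1 /=.
  by rewrite (_ : (-1)%:~R = -1) //; ring.
rewrite !mulrA -exprMn mulrNN mulr1 expr1n mul1r divff //.
by rewrite pnatr_eq0 -lt0n fact_gt0.
Qed.

Section Weights.
Variables (n : nat) (adj : rel 'I_n) (b : 'I_n -> int).
Hypotheses (adj_sym : symmetric adj) (adj_irr : irreflexive adj).
Implicit Types (A B C J X : {set 'I_n}) (r u v w : 'I_n) (g : 'I_n -> int).
Implicit Types (x : 'I_n -> rat) (y : {ffun 'I_n -> int}) (c d : pred {ffun 'I_n -> int}).

Notation utree := (utree adj).
Notation joined := (joined adj).
Notation deg := (deg adj).

(** The negated intersection matrix, once [b] is taken to be the negated Euler numbers. *)
Definition lap x v : rat := (b v)%:~R * x v - \sum_(w | adj v w) x w.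

Definition qpos : Prop := forall x, (exists v, x v != 0) -> 0 < \sum_v x v * lap x v.

Hypothesis lap_pos : qpos.

Lemma lap_adjoint x (z : 'I_n -> rat) : \sum_v x v * lap z v = \sum_v z v * lap x v.
Proof.
have E x' z' : \sum_v x' v * lap z' v =
    \sum_v (b v)%:~R * (x' v * z' v) - \sum_v \sum_w (if adj v w then x' v * z' w else 0).
  rewrite -sumrB; apply: eq_bigr => v _; rewrite /lap mulrBr mulr_sumr -big_mkcond /=.
  by congr (_ - _); ring.
rewrite !E exchange_big /=; congr (_ - _).
  by apply: eq_bigr => v _; rewrite [x v * _]mulrC.
by apply: eq_bigr => v _; apply: eq_bigr => w _; rewrite adj_sym mulrC.
Qed.

(* [gam] is the Schur complement at [r] of the form restricted to [C]. *)
Definition pivot C r (gam : rat) : Prop := exists x,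
  [/\ forall v, v \in C -> 0 < x v, forall v, v \notin C -> x v = 0, x r = 1,
      forall v, v \in C -> v != r -> lap x v = 0 & lap x r = gam].

(** [gam] is the value of the form at [x]: outside [C] the vector vanishes, and on [C] away from [r]
    its image does. *)
Lemma pivot_gt0 C r gam : r \in C -> pivot C r gam -> 0 < gam.
Proof.
move=> rC [x [_ xN xr xC xg]].
have : 0 < \sum_v x v * lap x v by apply: lap_pos; exists r; rewrite xr oner_eq0.
rewrite (bigD1 r) //= xr mul1r xg big1 ?addr0 // => v ne_vr.
by have [vC|/xN->] := boolP (v \in C); rewrite ?mul0r // xC ?mulr0.
Qed.

Lemma pivot1 r : pivot [set r] r (b r)%:~R.
Proof.
exists (fun v => if v == r then 1 else 0); split=> [v|v||v|]; rewrite ?inE ?eqxx //.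
- by move/eqP->; rewrite eqxx.
- by move/negPf->.
- by move=> ->.
rewrite /lap eqxx mulr1 big1 ?subr0 // => w rw; case: eqP => // wr.
by move: rw; rewrite wr adj_irr.
Qed.

(** A vector supported on [B] is felt in [A] only through the edge, hence only at [r]. *)
Lemma lap_off A B r u x v : joined A B r u -> v \in A ->
  (forall w, w \notin B -> x w = 0) -> lap x v = - (if v == r then x u else 0).
Proof.
move=> [rA uB dAB ru AB] vA xB; rewrite /lap xB ?(disjointFr dAB vA) // mulr0 sub0r.
congr (- _); case: eqVneq => [->|ne_vr].
  rewrite (bigD1 u) //= big1 ?addr0 // => w /andP[rw ne_wu].
  have [wB|/xB//] := boolP (w \in B); have [_ wu] := AB _ _ rA wB rw.
  by rewrite wu eqxx in ne_wu.
rewrite big1 // => w vw; have [wB|/xB//] := boolP (w \in B).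
by have [vr] := AB _ _ vA wB vw; rewrite vr eqxx in ne_vr.
Qed.

Lemma lap_lin x (z : 'I_n -> rat) (a : rat) v :
  lap (fun w => x w + a * z w) v = lap x v + a * lap z v.
Proof. by rewrite /lap big_split /= -mulr_sumr; ring. Qed.

(** The vector of [B] is scaled by [gB^-1], so that at [u] it cancels the [-1] coming from the
    neighbour [r]; at [r] it then contributes [- gB^-1]. *)
Lemma pivotU A B r u gA gB : joined A B r u ->
  pivot A r gA -> pivot B u gB -> pivot (A :|: B) r (gA - gB^-1).
Proof.
move=> jAB pA pB; have [rA uB dAB ru _] := jAB; have jBA := joinedC adj_sym jAB.
have gB0 : 0 < gB := pivot_gt0 uB pB.
case: pA pB => x [xA xN xr xC xg] [z [zB zN zr zC zg]].
exists (fun v => x v + gB^-1 * z v); split.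
- move=> v; rewrite inE => /orP[vA|vB].
    by rewrite (zN v) ?(disjointFr dAB vA) // mulr0 addr0 xA.
  by rewrite (xN v) ?(disjointFl dAB vB) // add0r mulr_gt0 ?zB // invr_gt0.
- by move=> v; rewrite inE negb_or => /andP[/xN -> /zN ->]; rewrite mulr0 addr0.
- by rewrite xr zN ?(disjointFr dAB rA) // mulr0 addr0.
- move=> v + ne_vr; rewrite lap_lin inE => /orP[vA|vB].
    by rewrite xC // (lap_off jAB vA zN) (negPf ne_vr) oppr0 mulr0 addr0.
  rewrite (lap_off jBA vB xN); case: eqVneq => [->|ne_vu].
    by rewrite xr zg mulVf ?lt0r_neq0 // addrC subrr.
  by rewrite zC // mulr0 oppr0 addr0.
by rewrite lap_lin xg (lap_off jAB rA zN) eqxx zr mulrN1.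
Qed.

Lemma pivot_exists C r : utree C -> r \in C -> exists gam, pivot C r gam.
Proof.
move: C r; apply: (utree_rooted_ind adj_sym) => [s|A B s u jAB _ _ [gA pA] [gB pB]].
  by exists (b s)%:~R; apply: pivot1.
by exists (gA - gB^-1); apply: pivotU pA pB.
Qed.

(** * Admissible vectors, their weights and finiteness *)

Definition arg g y v : int := g v + b v * y v - \sum_(w | adj v w) y w.

Definition supp C y : bool := [forall v, (v \notin C) ==> (y v == 0)].

Definition adm C g y : bool := supp C y && [forall v in C, 0 <= arg g y v].

(* With [y = l' - l'_0] and [g] the E^*-coordinates of [l'_0], the E^*-coordinates of [l'] are
   [arg g y], and [wt C g y] is the coefficient at [l'] of the series of the subgraph [C]. *)
Definition wt C g y : rat :=
  if supp C y then \prod_(v in C) ser ((deg C v)%:Z - 2) (arg g y v) else 0.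

Definition nonneg J y : bool := [forall v in J, 0 <= y v].

Definition upd g r (t : int) : 'I_n -> int := fun v => if v == r then t else g v.

Lemma suppP C y : reflect (forall v, v \notin C -> y v = 0) (supp C y).
Proof. by apply: (iffP forallP) => H v; [move/(implyP (H v))/eqP|apply/implyP => /H ->]. Qed.

Lemma nonnegP J y : reflect (forall v, v \in J -> 0 <= y v) (nonneg J y).
Proof. exact: forall_inP. Qed.

Lemma wt_adm C g y : wt C g y != 0 -> adm C g y.
Proof.
rewrite /wt /adm; case: (supp C y) => //=.
move=> W; apply/forall_inP => v vC; apply: contraNT W => av.
by rewrite (bigD1 v) //= /ser (negPf av) mul0r.
Qed.

Lemma eq_arg g g' y v : g v = g' v -> arg g y v = arg g' y v.
Proof. by rewrite /arg => ->. Qed.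

Lemma arg_upd g r t y : arg (upd g r t) y r = arg g y r - g r + t.
Proof. by rewrite /arg /upd eqxx; ring. Qed.

Lemma argE g y v : (arg g y v)%:~R = (g v)%:~R + lap (fun w => (y w)%:~R) v :> rat.
Proof.
rewrite /arg /lap rmorphB rmorphD rmorphM /= -addrA; congr (_ + (_ - _)).
by rewrite rmorph_sum.
Qed.

(** Self-adjointness moves [lap] onto [x], where only the value [gam] at [r] survives; so the
    pairing depends on [y] through [y r] alone. *)
Lemma pivot_pairing C r gam (x : 'I_n -> rat) g y :
  (forall v, v \notin C -> x v = 0) -> r \in C ->
  (forall v, v \in C -> v != r -> lap x v = 0) -> lap x r = gam -> supp C y ->
  \sum_v x v * (arg g y v)%:~R = \sum_v x v * (g v)%:~R + gam * (y r)%:~R.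
Proof.
move=> xN rC xC xg /suppP yN.
rewrite (eq_bigr (fun v => x v * (g v)%:~R + x v * lap (fun w => (y w)%:~R) v)); last first.
  by move=> v _; rewrite argE mulrDr.
rewrite big_split /= lap_adjoint; congr (_ + _).
rewrite (bigD1 r) //= xg [_%:~R * gam]mulrC big1 ?addr0 // => v ne_vr.
by have [vC|/yN->] := boolP (v \in C); rewrite ?mul0r // xC ?mulr0.
Qed.

(** The difference of [y] and [y'] vanishes outside [C] and [lap] of it vanishes on [C], so the
    positive definite form is zero at it. *)
Lemma arg_inj C g y y' : supp C y -> supp C y' ->
  (forall v, v \in C -> arg g y v = arg g y' v) -> y = y'.
Proof.
move=> /suppP yN /suppP y'N eqa; apply/ffunP => v0; apply/eqP; apply: contraT => ne_y.
pose z v : rat := (y v)%:~R - (y' v)%:~R.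
have : 0 < \sum_v z v * lap z v.
  by apply: lap_pos; exists v0; rewrite subr_eq0 eqr_int.
rewrite big1 ?ltxx // => v _; have [vC|vC] := boolP (v \in C); last first.
  by rewrite /z yN // y'N // subrr mul0r.
suff -> : lap z v = 0 by rewrite mulr0.
have := congr1 (fun i => i%:~R : rat) (eqa v vC); rewrite !argE => /addrI e.
rewrite (_ : lap z v = lap (fun w => (y w)%:~R) v - lap (fun w => (y' w)%:~R) v).
  by rewrite e subrr.
by rewrite /lap [in LHS]sumrB /z; ring.
Qed.

(** The vector of [pivot] is positive on [C], so [pivot_pairing] bounds a positive combination of
    the nonnegative integers [arg g y v] by means of [y r]. They take finitely many values, and
    determine [y] by [arg_inj]. *)
Lemma adm_finite C g r (M : int) : utree C -> r \in C ->
  listable (fun y => adm C g y /\ y r <= M).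
Proof.
move=> tC rC; have [gam pC] := pivot_exists tC rC; have gam0 := pivot_gt0 rC pC.
case: pC => x [xC xN xr xL xg].
pose T := \sum_v x v * (g v)%:~R + gam * M%:~R.
pose U := (\sum_v Num.bound `|T / x v|)%N.
have bnd y v : adm C g y /\ y r <= M -> v \in C -> 0 <= arg g y v /\ arg g y v <= U%:Z.
  case=> /andP[sy /forall_inP ay] yM vC; split; first exact: ay.
  have leT : x v * (arg g y v)%:~R <= T.
    apply: (@le_trans _ _ (\sum_v x v * (arg g y v)%:~R)).
      rewrite [X in _ <= X](bigD1 v) //= lerDl; apply: sumr_ge0 => w _.
      have [wC|/xN->] := boolP (w \in C); last by rewrite mul0r.
      by rewrite mulr_ge0 ?ler0z ?ay // ltW ?xC.
    by rewrite (pivot_pairing g xN rC xL xg sy) lerD2l ler_pM2l // ler_int.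
  have xv := xC v vC.
  have : (arg g y v)%:~R < (Num.bound `|T / x v|)%:R :> rat.
    apply: le_lt_trans (archi_boundP (normr_ge0 _)); apply: le_trans (ler_norm _).
    by rewrite ler_pdivlMr // mulrC.
  rewrite -[(Num.bound _)%:R]/((Num.bound `|T / x v|)%:Z%:~R) ltr_int => /ltW /le_trans; apply.
  by rewrite lez_nat /U (bigD1 v) //= leq_addr.
pose f y : {ffun 'I_n -> 'I_U.+1} := [ffun v => if v \in C then inord `|arg g y v|%N else ord0].
apply: (@listable_inj _ _ [ffun=> 0] _ f) => y y' Py Py' eqf.
have [/andP[sy _] _] := Py; have [/andP[sy' _] _] := Py'.
apply: (@arg_inj C g) => // v vC.
have [a0 aU] := bnd _ _ Py vC; have [a0' aU'] := bnd _ _ Py' vC.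
have := congr1 (fun F : {ffun 'I_n -> 'I_U.+1} => val (F v)) eqf; rewrite !ffunE vC /= !inordK; lia.
Qed.

(** Finiteness is asked for all [g] at once because the same condition is reused after shifts of [g]
    at a root. *)
Definition finc C c : Prop := forall g, listable (fun y => adm C g y /\ c y).

Lemma finc_sub C c d : (forall y, d y -> c y) -> finc C c -> finc C d.
Proof. by move=> dc fc g; apply: listable_sub (fc g) => y [ay /dc]. Qed.

Lemma finc_root C r k d : utree C -> r \in C -> finc C (fun y => (y r == k) && d y).
Proof.
move=> tC rC g; apply: listable_sub (adm_finite g k tC rC) => y [ay /andP[/eqP-> _]].
by split.
Qed.

(** A negative coordinate of [y] lies in [C], and [adm_finite] rooted at that vertex applies; the
    union over vertices is finite. *)
Lemma finc_neg C J : utree C -> finc C (fun y => ~~ nonneg J y).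
Proof.
move=> tC g.
have fin v : listable (fun y => [/\ adm C g y, v \in C & y v <= 0]).
  have [vC|vC] := boolP (v \in C); last by exists [::] => y [].
  by apply: listable_sub (adm_finite g 0 tC vC) => y [].
apply: listable_sub (listable_ex fin) => y [ay /forall_inPn[v vJ]].
rewrite -ltNge => yv; exists v; split=> //; last exact: ltW.
by case/andP: ay => /suppP sy _; apply: contraTT yv => /sy ->.
Qed.

Definition wsum C c g : rat := fsum (fun y => if c y then wt C g y else 0).

Lemma wsum_fsupp C c g : finc C c -> fsupp (fun y => if c y then wt C g y else 0).
Proof.
by move=> /(_ g); apply: listable_sub => y; case: (c y) => [/wt_adm|]; rewrite ?eqxx.
Qed.

Lemma eq_wsum C c d g : (forall y, supp C y -> c y = d y) -> wsum C c g = wsum C d g.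
Proof.
move=> cd; apply: eq_fsum => y; rewrite /wt; case: (boolP (supp C y)) => [/cd->//|_].
by rewrite !if_same.
Qed.

Lemma wsum_split C c d g : finc C c ->
  wsum C c g = wsum C (fun y => c y && d y) g + wsum C (fun y => c y && ~~ d y) g.
Proof.
move=> fc; rewrite /wsum -fsumD.
- by apply: eq_fsum => y; case: (c y); case: (d y); rewrite ?addr0 ?add0r.
- by apply/wsum_fsupp/(finc_sub _ fc) => y /andP[].
by apply/wsum_fsupp/(finc_sub _ fc) => y /andP[].
Qed.

(** Lowering [g r] leaves only vectors that were admissible for [g], a finite list on which
    [arg g y r] is at most [T]. Below the chosen threshold the coordinate at [r] is negative for all
    of them. *)
Lemma wsum_low C c g r : finc C c -> r \in C -> lowsupp (fun t => wsum C c (upd g r t)).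
Proof.
move=> fc rC; have [s Hs] := fc g.
pose T := \sum_(y <- s) `|arg g y r|.
exists (g r - 1 - T) => t let_; apply: fsum0 => y; case: ifP => // cy; apply/eqP.
have T0 : 0 <= T by apply: sumr_ge0.
apply: contraT => /wt_adm /andP[sy /forall_inP ay].
have ys : y \in s.
  apply: Hs; split=> //; rewrite /adm sy; apply/forall_inP => v vC.
  have := ay v vC; have [->|ne_vr] := eqVneq v r; first by rewrite arg_upd; lia.
  by rewrite (@eq_arg _ g) // /upd (negPf ne_vr).
have := ay r rC; rewrite arg_upd.
have : `|arg g y r| <= T by rewrite /T (big_rem y) //= lerDl sumr_ge0.
lia.
Qed.

Lemma wsum_fiber C c g r : finc C c ->
  fsupp (fun t => wsum C (fun y => (y r == t) && c y) g) /\
  wsum C c g = fsum (fun t => wsum C (fun y => (y r == t) && c y) g).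
Proof.
move=> fc; have F := wsum_fsupp g fc.
have E t : fsum (fun y => if y r == t then if c y then wt C g y else 0 else 0) =
    wsum C (fun y => (y r == t) && c y) g.
  by apply: eq_fsum => y; case: eqP.
split; last by rewrite /wsum (fsum_fiber (fun y => y r) F); apply: eq_fsum.
by rewrite -(functional_extensionality _ _ E); apply: fsupp_fiber.
Qed.

(** Only finitely many admissible [y] have [y r <= 0], so the root values are bounded below. *)
Lemma wsum_lowt C d g r : utree C -> r \in C ->
  lowsupp (fun t => wsum C (fun y => (y r == t) && d y) g).
Proof.
move=> tC rC; have [s Hs] := adm_finite g 0 tC rC.
pose T := \sum_(y <- s) `|y r|; have T0 : 0 <= T by apply: sumr_ge0.
exists (- 1 - T) => t let_; apply: fsum0 => y.
case: ifP => // /andP[/eqP yt _]; apply/eqP; apply: contraT => /wt_adm ay.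
have ys : y \in s by apply: Hs; split=> //; lia.
have leT : `|y r| <= T by rewrite /T (big_rem y) //= lerDl sumr_ge0.
move: let_ leT; rewrite yt; move: (T) T0; lia.
Qed.

(** * Factorization of weights along an edge *)

Definition restr A y : {ffun 'I_n -> int} := [ffun v => if v \in A then y v else 0].

Lemma supp_restr A y : supp A (restr A y).
Proof. by apply/suppP => v vA; rewrite ffunE (negPf vA). Qed.

Lemma eq_wt C g g' y : (forall v, v \in C -> g v = g' v) -> wt C g y = wt C g' y.
Proof.
by move=> gg'; rewrite /wt; case: supp => //; apply: eq_bigr => v /gg'/eq_arg ->.
Qed.

Lemma eq_wsum_shift C c g g' : (forall v, v \in C -> g v = g' v) -> wsum C c g = wsum C c g'.
Proof. by move=> gg'; apply: eq_fsum => y; rewrite (eq_wt y gg'). Qed.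

(** Seen from [A], the other side shifts [g r] by [- y u], and the edge raises the exponent at [r]
    by one, which [serS] turns into a difference. *)
Lemma wt_half A B r u g y : joined A B r u -> supp (A :|: B) y ->
  \prod_(v in A) ser ((deg (A :|: B) v)%:Z - 2) (arg g y v) =
  wt A (upd g r (g r - y u)) (restr A y) - wt A (upd g r (g r - y u - 1)) (restr A y).
Proof.
move=> jAB sy; have [rA uB dAB ru _] := jAB.
have argA t v : v \in A -> arg (upd g r (g r - y u + t)) (restr A y) v =
    arg g y v + (if v == r then t else 0).
  move=> vA; suff : (arg (upd g r (g r - y u + t)) (restr A y) v)%:~R =
      (arg g y v)%:~R + (if v == r then t else 0)%:~R :> rat.
    by rewrite -rmorphD => /intr_inj.
  rewrite !argE.
  have -> : lap (fun w => (y w)%:~R) v =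
      lap (fun w => (restr A y w)%:~R + 1 * (restr B y w)%:~R) v.
    congr lap; apply: functional_extensionality => w; rewrite !ffunE mul1r.
    case: (boolP (w \in A)) => wA; first by rewrite (disjointFr dAB wA) addr0.
    case: (boolP (w \in B)) => wB; first by rewrite add0r.
    by move/suppP: sy => ->; rewrite ?addr0 // inE negb_or wA.
  rewrite lap_lin (@lap_off A B r u (fun w => (restr B y w)%:~R) v jAB vA) => [|w wB];
    last by rewrite ffunE (negPf wB).
  rewrite /upd ffunE uB; case: eqVneq => [->|_].
    by rewrite rmorphD rmorphB /=; ring.
  by rewrite oppr0 mulr0 !addr0.
have wtA t : wt A (upd g r (g r - y u + t)) (restr A y) =
    ser ((deg A r)%:Z - 2) (arg g y r + t) *
    \prod_(v in A | v != r) ser ((deg A v)%:Z - 2) (arg g y v).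
  rewrite /wt supp_restr (bigD1 r) //= argA // eqxx; congr (_ * _).
  by apply: eq_bigr => v /andP[vA ne_vr]; rewrite argA // (negPf ne_vr) addr0.
have := wtA 0; rewrite !addr0 => ->; rewrite wtA -mulrBl -serS.
rewrite (bigD1 r) //=; congr (ser _ _ * _).
  by rewrite (joined_deg jAB rA) eqxx; lia.
by apply: eq_bigr => v /andP[vA ne_vr]; rewrite (joined_deg jAB vA) (negPf ne_vr) addn0.
Qed.

Lemma wt_joined A B r u g y : joined A B r u -> supp (A :|: B) y ->
  wt (A :|: B) g y =
  (wt A (upd g r (g r - y u)) (restr A y) - wt A (upd g r (g r - y u - 1)) (restr A y)) *
  (wt B (upd g u (g u - y r)) (restr B y) - wt B (upd g u (g u - y r - 1)) (restr B y)).
Proof.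
move=> jAB sy; have jBA := joinedC adj_sym jAB; have [_ _ dAB _ _] := jAB.
have sy' : supp (B :|: A) y by rewrite setUC.
rewrite -(wt_half g jAB sy) -(wt_half g jBA sy') [B :|: A]setUC {1}/wt sy.
by rewrite -bigU //=; apply: eq_bigl => v; rewrite !inE.
Qed.

(* Both branches only see the root value of the other one, through a shift of [g]; the factor
   [1 - shift] at each end is the contribution of the edge to the exponents [deg - 2]. *)
Lemma wsum_joined A B r u g J k : joined A B r u -> utree A -> utree B ->
  wsum (A :|: B) (fun y => (y r == k) && nonneg J y) g =
  fsum (fun t =>
    (wsum B (fun y => (y u == t) && nonneg J y) (upd g u (g u - k)) -
     wsum B (fun y => (y u == t) && nonneg J y) (upd g u (g u - k - 1))) *
    (wsum A (fun y => (y r == k) && nonneg J y) (upd g r (g r - t)) -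
     wsum A (fun y => (y r == k) && nonneg J y) (upd g r (g r - t - 1)))).
Proof.
move=> jAB tA tB; have [rA uB dAB ru _] := jAB.
have tAB : utree (A :|: B) by apply: utreeU jAB tA tB.
have rAB : r \in A :|: B by rewrite inE rA.
pose cA := fun y : {ffun 'I_n -> int} => (y r == k) && nonneg J y.
pose cB t := fun y : {ffun 'I_n -> int} => (y u == t) && nonneg J y.
have fA : finc A cA by apply: finc_root.
have fB t : finc B (cB t) by apply: finc_root.
pose al t y := (if cA y then wt A (upd g r (g r - t)) y else 0) -
               (if cA y then wt A (upd g r (g r - t - 1)) y else 0).
pose be t y := (if cB t y then wt B (upd g u (g u - k)) y else 0) -
               (if cB t y then wt B (upd g u (g u - k - 1)) y else 0).
have alS t : fsupp (al t) by apply: fsuppB; apply: wsum_fsupp.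
have beS t : fsupp (be t) by apply: fsuppB; apply: wsum_fsupp.
pose f y := if cA y then wt (A :|: B) g y else 0.
pose F (s : int * ({ffun 'I_n -> int} * {ffun 'I_n -> int})) := be s.1 s.2.1 * al s.1 s.2.2.
have Ff : fsupp f by apply: wsum_fsupp; apply: finc_root.
(* [h] cuts [y] into its value at [u] and its two restrictions, and [h'] glues them back. They are
   inverse on the supports, where the first entry agrees with the value at [u]. *)
pose h y := (y u, (restr B y, restr A y)).
pose h' (s : int * ({ffun 'I_n -> int} * {ffun 'I_n -> int})) : {ffun 'I_n -> int} :=
  [ffun v => s.2.1 v + s.2.2 v].
have hK y : supp (A :|: B) y -> h' (h y) = y.
  move=> /suppP sy; apply/ffunP => v; rewrite !ffunE.
  case: (boolP (v \in A)) => vA; first by rewrite (disjointFr dAB vA) add0r.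
  case: (boolP (v \in B)) => vB; first by rewrite addr0.
  by rewrite sy ?addr0 // inE negb_or vA.
have Fh y : supp (A :|: B) y -> F (h y) = f y.
  move=> sy; rewrite /F /h /f /= /be /al /cA /cB !ffunE rA uB eqxx /=.
  have -> : nonneg J y = nonneg J (restr A y) && nonneg J (restr B y).
    apply/nonnegP/andP => [Jy|[/nonnegP JA /nonnegP JB] v vJ].
      by split; apply/nonnegP => v /Jy; rewrite ffunE; case: ifP.
    have := hK y sy => /(congr1 (fun y' : {ffun 'I_n -> int} => y' v)) <-.
    by rewrite ffunE addr_ge0 ?JA ?JB.
  have [yk|] := eqVneq (y r) k; last by rewrite subr0 mulr0.
  rewrite (wt_joined g jAB sy) yk.
  by case: nonneg; case: nonneg; rewrite /= ?subr0 ?mulr0 ?mul0r // mulrC.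
have FP s : F s != 0 -> [/\ supp B s.2.1, supp A s.2.2 & s.2.1 u = s.1].
  case: s => t [yB yA]; rewrite /F /= mulf_eq0 negb_or /be /al /cB /cA /wt.
  case: (supp A yA); case: (supp B yB); rewrite ?if_same ?subrr ?eqxx ?andbF //.
  by case: (yB u =P t) => [->//|_]; rewrite /= ?subrr ?eqxx.
have hK' s : F s != 0 -> supp (A :|: B) (h' s) /\ h (h' s) = s.
  move=> /FP; case: s => t [yB yA] /= [/suppP sB /suppP sA yt]; split.
    by apply/suppP => v; rewrite inE negb_or ffunE => /andP[/sA -> /sB ->].
  rewrite /h /h' !ffunE /= (sA u) ?(disjointFl dAB uB) // addr0 yt.
  congr (_, (_, _)); apply/ffunP => v; rewrite !ffunE /=.
    case: ifP => [vB|/negbT/sB->//]; by rewrite (sA v) ?(disjointFl dAB vB) // addr0.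
  case: ifP => [vA|/negbT/sA->//]; by rewrite (sB v) ?(disjointFr dAB vA) // add0r.
have f_supp y : f y != 0 -> supp (A :|: B) y.
  by rewrite /f /wt; case: supp => //; rewrite if_same eqxx.
have fF y : f y != 0 -> h' (h y) = y /\ F (h y) = f y.
  by move/f_supp => sy; split; [apply: hK|apply: Fh].
have Ffh s : F s != 0 -> h (h' s) = s /\ f (h' s) = F s.
  by move=> /hK'[sy hs]; split=> //; rewrite -Fh // hs.
have FF : fsupp F.
  by have [r' [_ FS _]] := has_fsum_reindex fF Ffh (has_fsum_fsum Ff); exists r'.
rewrite [LHS](fsum_reindex fF Ffh Ff) fsum_pair //; apply: eq_fsum => t.
rewrite /F /= fsum_mul // /be /al !fsumB //; exact: wsum_fsupp.
Qed.

(** * Counting functions of subtrees and removal of vertices *)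

Definition Q C J g : rat := wsum C (fun y => ~~ nonneg J y) g.

(** The value [t] of [g] at the root is kept apart because it is the exponent of the series that
    gets convolved when a branch is added. *)
Definition Sroot C r J g t k : rat := wsum C (fun y => (y r == k) && nonneg J y) (upd g r t).

Definition Sneg C r J g t k : rat := wsum C (fun y => (y r == k) && ~~ nonneg J y) (upd g r t).

Definition bigK C r (K : int) g : Prop := forall v, v \in C -> v != r -> K <= g v.

(* [s] lists the branches of [C] at [r] with their roots. *)
Definition stable C r (gam : rat) (K : int) (s : seq ({set 'I_n} * 'I_n)) : Prop :=
  forall g J t k, bigK C r K g -> 0 <= k -> K%:~R <= t%:~R + gam * k%:~R ->
    Sroot C r J g t k - Sroot C r J g (t - 1) k = 1 /\
    Sneg C r J g t k = \sum_(p <- s)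
      (Q p.1 J (upd g p.2 (g p.2 - k)) - Q p.1 J (upd g p.2 (g p.2 - k - 1))).

(** The only vector with root value [k] is [y0]. Its weight has exponent [-2], with difference the
    geometric series, and [y0] is nonnegative, so nothing violates the sign condition. *)
Lemma stable1 r : stable [set r] r (b r)%:~R 0 [::].
Proof.
move=> g J t k _ k0; rewrite big_nil -rmorphM -rmorphD ler_int => t_ge.
pose y0 : {ffun 'I_n -> int} := [ffun v => if v == r then k else 0].
have y0E y : supp [set r] y -> y r = k -> y = y0.
  move=> /suppP sy yk; apply/ffunP => v; rewrite ffunE.
  by case: eqVneq => [->//|ne_vr]; apply: sy; rewrite inE.
have nn : nonneg J y0 by apply/nonnegP => v _; rewrite ffunE; case: ifP.
have rootE z : Sroot [set r] r J g z k = ser (-2) (z + b r * k).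
  rewrite /Sroot /wsum (@fsum_seq _ _ [:: y0]) // => [|y].
    rewrite big_seq1 ffunE eqxx nn /wt.
    have -> : supp [set r] y0 by apply/suppP => v; rewrite inE ffunE => /negPf->.
    rewrite big_set1 (deg1 adj_irr) /arg /upd eqxx ffunE eqxx big1 ?subr0 // => w rw.
    by rewrite ffunE; case: eqP => // wr; rewrite wr adj_irr in rw.
  rewrite inE /wt; case: (boolP (supp [set r] y)) => [sy|_]; last by rewrite if_same eqxx.
  by case: (y r =P k) => [/(y0E _ sy)->|]; rewrite eqxx.
split.
  by rewrite !rootE addrAC -serS; apply: ser_geom.
apply: fsum0 => y; rewrite /wt; case: (boolP (supp [set r] y)) => [sy|_]; last by rewrite if_same.
by case: (y r =P k) => [/(y0E _ sy)->|]; rewrite ?nn ?andbF.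
Qed.

(** [set0] imposes no sign condition, so it gives the full sum over vectors with root value [k]. *)
Lemma SnegE C r J g t k : utree C -> r \in C ->
  Sneg C r J g t k = Sroot C r set0 g t k - Sroot C r J g t k.
Proof.
move=> tC rC; pose c := fun y : {ffun 'I_n -> int} => y r == k.
have fc : finc C c.
  by apply: finc_sub (finc_root k predT tC rC) => y; rewrite /c => ->.
have -> : Sroot C r set0 g t k = wsum C c (upd g r t).
  apply: eq_wsum => y _; rewrite (_ : nonneg set0 y) ?andbT //.
  by apply/nonnegP => v; rewrite inE.
by rewrite (wsum_split (nonneg J) _ fc) addrC addKr.
Qed.

(** [Sroot] of the union is a convolution of two step sequences, one per side of the edge. The Schur
    complement [gA - gB^-1] is exactly what lets their thresholds add up to at most [t]. *)
Lemma stableU A B r u gA gB KA KB s : joined A B r u -> utree A -> utree B -> 0 < gB ->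
  stable A r gA KA s -> (exists s', stable B u gB KB s') ->
  stable (A :|: B) r (gA - gB^-1) (Num.max (KA + 2) KB) ((B, u) :: s).
Proof.
move=> jAB tA tB gB0 stA [s' stB] g J t k gK k0 tK.
have [rA uB dAB ru _] := jAB.
have tAB : utree (A :|: B) by apply: utreeU jAB tA tB.
have rAB : r \in A :|: B by rewrite inE rA.
have ne_ur : u != r by apply/eqP => ur; move: (disjointFr dAB rA); rewrite -ur uB.
pose K := Num.max (KA + 2) KB; have KA2 : KA + 2 <= K by rewrite le_max lexx.
have KKB : KB <= K by rewrite le_max lexx orbT.
have gA_big : bigK A r KA g.
  by move=> v vA ne_vr; have := gK v; rewrite inE vA -/K => /(_ isT ne_vr); lia.
have gB_big v : v \in B -> KB <= g v.
  move=> vB; have ne_vr : v != r by apply: contraTneq rA => <-; rewrite (disjointFl dAB vB).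
  by have := gK v; rewrite inE vB orbT -/K => /(_ isT ne_vr); lia.
(* [Phi] varies with the value of [y] at [u], [Ea] with the value of [g] at [r]; their differences
   are the edge factors in [wsum_joined]. *)
pose Phi J' z := Sroot B u J' g (g u - k) z - Sroot B u J' g (g u - k - 1) z.
pose Ea J' z := Sroot A r J' g z k - Sroot A r J' g (z - 1) k.
have convE J' z : Sroot (A :|: B) r J' g z k = fsum (fun t => Phi J' t * Ea J' (z - t)).
  rewrite /Sroot (wsum_joined _ _ _ jAB tA tB); apply: eq_fsum => t'.
  congr (_ * _).
    by congr (_ - _); apply: eq_wsum_shift => v vB; rewrite /upd (negPf ne_ur); case: eqP => // _;
      case: eqP vB => // ->; rewrite (disjointFr dAB rA).
  by congr (_ - _); apply: eq_wsum_shift => v vA; rewrite /upd eqxx; case: eqP.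
have lowG J' : lowsupp (fun z => Sroot A r J' g z k) by apply: wsum_low => //; apply: finc_root.
have lowE J' : lowsupp (Ea J') by apply: lowsupp_diff.
have lowP J' : lowsupp (Phi J') by apply: lowsupp_sub; apply: wsum_lowt.
(* From [D1] on, [gB] times the value at [u] makes up for the shift of [g u] by [- k]; [D2] is the
   threshold of [A]. Each rounding costs less than 1, whence [KA + 2] in the bound. *)
pose D1 := Num.ceil (k%:~R / gB); pose D2 := Num.ceil (KA%:~R - gA * k%:~R).
have D2P z : D2 <= z -> KA%:~R <= z%:~R + gA * k%:~R.
  by rewrite ceil_le_int lerBlDr.
have stepE J' : isstep (Ea J') D2.
  by split=> // z /D2P zD; have [] := stA g J' z k gA_big k0 zD.
have stepP J' : isstep (Phi J') D1.
  split=> // z; rewrite ceil_le_int ler_pdivrMr // => zD.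
  have z0 : 0 <= z.
    rewrite -(ler0z rat) -(pmulr_lge0 _ gB0); apply: le_trans zD; by rewrite ler0z.
  suff /(stB g J' (g u - k) z _ z0)[] : KB%:~R <= (g u - k)%:~R + gB * z%:~R.
    - by move=> v vB _; apply: gB_big.
    - by [].
  rewrite rmorphB /= -addrA; apply: (@le_trans _ _ (g u)%:~R); first by rewrite ler_int gB_big.
  by rewrite lerDl addrC subr_ge0 mulrC.
have ceilD1 (a : rat) : (Num.ceil a)%:~R < a + 1.
  by have /andP[+ _] := ceil_itv a; rewrite rmorphB /= ltrBlDr.
have leD : D1 + D2 <= t.
  rewrite -(ler_int rat) rmorphD /=.
  have h1 : D1%:~R < k%:~R / gB + 1 by apply: ceilD1.
  have h2 : D2%:~R < KA%:~R - gA * k%:~R + 1 by apply: ceilD1.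
  have h3 : KA%:~R + 2 <= t%:~R + (gA - gB^-1) * k%:~R.
    by apply: le_trans tK; rewrite -(rmorphD _ KA 2) ler_int.
  by move: h1 h2 h3; rewrite mulrBl [gB^-1 * _]mulrC; lra.
split.
  rewrite !convE -(isstep_conv (stepP J) (stepE J) leD) -fsumB; try exact: fsupp_conv.
  by apply: eq_fsum => z; rewrite -mulrBr; congr (_ * (_ - Ea J _)); ring.
rewrite (SnegE _ _ _ _ tAB rAB) !convE -fsumB; try exact: fsupp_conv.
rewrite (isstep_conv_diff (stepP set0) (stepE set0) (stepP J) (stepE J) leD) big_cons.
congr (_ + _).
  (* Summing over the values at [u] turns the change of [Phi] into a difference of counting
     functions of the branch [B]. *)
  have fin : finc B (fun y => ~~ nonneg J y) by apply: finc_neg.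
  have [f1 e1] := wsum_fiber (upd g u (g u - k)) u fin.
  have [f2 e2] := wsum_fiber (upd g u (g u - k - 1)) u fin.
  rewrite /Q /= e1 e2 -fsumB //; apply: eq_fsum => z.
  rewrite -[wsum B _ (upd g u (g u - k))]/(Sneg B u J g (g u - k) z).
  rewrite -[wsum B _ (upd g u (g u - k - 1))]/(Sneg B u J g (g u - k - 1) z).
  by rewrite !SnegE // /Phi; ring.
(* For [A] the change of [Ea] is a difference of [Sneg], which is eventually the constant given by
   the remaining branches; it telescopes to that constant. *)
have lowN : lowsupp (fun z => Sneg A r J g z k).
  by apply: wsum_low => //; apply: finc_sub (finc_root k predT tA rA) => y /andP[->].
have NE z : D2 <= z -> Sneg A r J g z k = \sum_(p <- s)
      (Q p.1 J (upd g p.2 (g p.2 - k)) - Q p.1 J (upd g p.2 (g p.2 - k - 1))).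
  by move=> /D2P zD; have [_ ->] := stA g J z k gA_big k0 zD.
have [_ <-] := fsum_telescope lowN NE; apply: eq_fsum => z.
by rewrite !SnegE // /Ea; ring.
Qed.

Lemma stable_exists C r : utree C -> r \in C -> exists gam K s,
  [/\ pivot C r gam, stable C r gam K s, comps_of adj (C :\ r) (map fst s)
    & forall p, p \in s -> p.2 \in p.1].
Proof.
move: C r; apply: (utree_rooted_ind adj_sym) => [r|A B r u jAB tA tB].
  exists (b r)%:~R, 0, [::]; split=> //; [exact: pivot1|exact: stable1|].
  rewrite (_ : _ :\ r = set0); first exact: comps_of0.
  by apply/setP => v; rewrite !inE andNb.
move=> [gA [KA [s [pA stA cA sA]]]] [gB [KB [s' [pB stB _ _]]]].
have [rA uB dAB ru AB] := jAB.
exists (gA - gB^-1), (Num.max (KA + 2) KB), ((B, u) :: s); split.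
- exact: pivotU pA pB.
- by apply: stableU => //; [apply: pivot_gt0 pB|exists s'].
- have -> : (A :|: B) :\ r = B :|: (A :\ r).
    rewrite setDUl setUC; congr (_ :|: _); apply/setDidPl.
    by rewrite disjoint_sym disjoints1 (disjointFr dAB rA).
  apply: comps_ofU => //.
    by rewrite disjoint_sym; apply: disjointWl dAB; apply: subsetDl.
  move=> v w vB; rewrite !inE => /andP[ne_wr wA]; apply/negP; rewrite adj_sym.
  by move=> /(AB _ _ wA vB)[wr]; rewrite wr eqxx in ne_wr.
by move=> p; rewrite inE => /orP[/eqP->//|/sA].
Qed.

(** Vectors with [y r < 0] give the first term, as [r] lies in [J]. Those with [y r = k >= 0] give,
    by [stable], a sum over the branches, which [fsum_tail] sums over [k]. *)
Lemma remove_vertex C r : utree C -> r \in C -> exists (K : int) s,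
  comps_of adj (C :\ r) s /\
  forall g J, (forall v, v \in C -> K <= g v) -> r \in J ->
    Q C J g = Q C [set r] g + \sum_(B <- s) Q B J g.
Proof.
move=> tC rC; have [gam [K [s [pC st cs sP]]]] := stable_exists tC rC.
have gam0 := pivot_gt0 rC pC; exists K, (map fst s); split=> // g J gK rJ.
have fin := finc_neg J tC.
pose neg_r := fun y : {ffun 'I_n -> int} => y r < 0.
rewrite /Q (wsum_split neg_r _ fin); congr (_ + _).
  apply: eq_wsum => y _; have -> : nonneg [set r] y = (0 <= y r).
    by apply/nonnegP/idP => [H|y0 v /set1P->//]; apply: H; rewrite set11.
  rewrite -ltNge andb_idl // => yr; apply/negP => /nonnegP/(_ r rJ).
  by rewrite leNgt => /negP; apply.
have fin' : finc C (fun y => ~~ nonneg J y && ~~ neg_r y).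
  by apply: finc_sub fin => y /andP[].
have [_ ->] := wsum_fiber g r fin'.
(* A branch sees the value [k] at [r] only as a lowering of [g] at its own root by [k]. *)
pose F (p : {set 'I_n} * 'I_n) z := Q p.1 J (upd g p.2 z).
pose T p k : rat := if 0 <= k then F p (g p.2 - k) - F p (g p.2 - k - 1) else 0.
have TP p : p \in s -> fsupp (T p) /\ fsum (T p) = Q p.1 J g.
  move=> ps; have tp : utree p.1 by apply: comps_of_utree cs _; apply: map_f.
  have [fT ->] := fsum_tail (g p.2) (wsum_low g (finc_neg J tp) (sP p ps)).
  by split=> //; apply: eq_wsum_shift => v vp; rewrite /upd; case: eqP => // ->.
have [|_ sumT] := @fsum_sum _ _ s T; first by move=> p /TP[].
rewrite big_map [RHS](eq_big_seq (fun p => fsum (T p))); last by move=> p /TP[_ ->].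
rewrite -sumT; apply: eq_fsum => k; have [k0|k0] := leP 0 k; last first.
  rewrite big1 => [|p _]; last by rewrite /T leNgt k0.
  apply: fsum0 => y; case: (y r =P k) => //= yk.
  by rewrite /neg_r yk k0 andbF.
rewrite (eq_bigr (fun p => Q p.1 J (upd g p.2 (g p.2 - k)) -
    Q p.1 J (upd g p.2 (g p.2 - k - 1)))); last by move=> p _; rewrite /T k0.
have [||_ <-] := st g J (g r) k _ k0 _.
- by move=> v vC _; apply: gK.
(* Because [gam] is positive, the bound on [g r] gives the threshold for all [k >= 0]
   simultaneously. *)
- apply: (@le_trans _ _ (g r)%:~R); first by rewrite ler_int gK.
  by rewrite lerDl mulr_ge0 ?ler0z // ltW.
rewrite /Sneg (@eq_wsum_shift C _ g (upd g r (g r))); last first.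
  by move=> v _; rewrite /upd; case: eqP => // ->.
apply: eq_wsum => y _; case: (y r =P k) => //= yk.
by rewrite /neg_r yk -leNgt k0 andbT.
Qed.

(** For [r] in both [C] and [I], the identities of [remove_vertex] with [J = setT] and with [J = I]
    share the term [Q C [set r] g]. Their difference reduces the claim to the branches at [r], which
    are smaller. *)
Lemma remove_set C (I : {set 'I_n}) : utree C -> exists (K : int) s,
  comps_of adj (C :\: I) s /\
  forall g, (forall v, v \in C -> K <= g v) ->
    Q C setT g = Q C I g + \sum_(D <- s) Q D setT g.
Proof.
move: {2}#|C|.+1 (ltnSn #|C|) => m; elim: m C => // m IHm C leC tC.
have [dCI|] := boolP [disjoint C & I].
  exists 0, [:: C]; split=> [|g _].
    have := comps_ofU tC (_ : [disjoint C & set0]) _ (comps_of0 adj).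
    rewrite setU0 (setDidPl _) //; apply.
      by rewrite -setI_eq0 setI0.
    by move=> v w _; rewrite inE.
  rewrite big_seq1 [X in _ = X + _](_ : _ = 0) ?add0r //; apply: fsum0 => y.
  rewrite /wt; case: suppP => [sy|_]; last by rewrite if_same.
  rewrite (_ : nonneg I y) //; apply/nonnegP => v vI.
  by rewrite sy // (disjointFl dCI vI).
rewrite -setI_eq0 => /set0Pn[r]; rewrite inE => /andP[rC rI].
have [K0 [s [cs sE]]] := remove_vertex tC rC.
(* The induction hypothesis is added up over the branches; thresholds combine by maximum and
   component lists by concatenation. *)
have lift X s0 : comps_of adj X s0 -> X \subset C :\ r -> exists (K : int) t,
    comps_of adj (X :\: I) t /\ forall g, (forall v, v \in X -> K <= g v) ->
    \sum_(B <- s0) Q B setT g = \sum_(B <- s0) Q B I g + \sum_(D <- t) Q D setT g.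
  elim=> [_|D Y s1 tD dDY nDY _ IH].
    exists 0, [::]; split=> [|g _]; first by rewrite set0D; apply: comps_of0.
    by rewrite !big_nil addr0.
  rewrite subUset => /andP[DC YC].
  have [|K1 [t1 [c1 e1]]] := IHm D _ tD.
    by have := subset_leq_card DC; have := cardsD1 r C; rewrite rC; lia.
  have [K2 [t2 [c2 e2]]] := IH YC.
  exists (Num.max K1 K2), (t1 ++ t2); split.
    rewrite setDUl; apply: comps_of_cat => //.
      by apply: disjointWl (subsetDl _ _) (disjointWr (subsetDl _ _) dDY).
    by move=> v w /setDP[vD _] /setDP[wY _]; apply: nDY.
  move=> g gK; rewrite !big_cons big_cat /= e1 ?e2; first by ring.
    by move=> v vY; have := gK v; rewrite inE vY orbT => /(_ isT); lia.
  by move=> v vD; have := gK v; rewrite inE vD => /(_ isT); lia.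
have [K1 [t [ct tE]]] := lift _ _ cs (subxx _).
exists (Num.max K0 K1), t; split.
  rewrite (_ : C :\: I = (C :\ r) :\: I) //; apply/setP => v; rewrite !inE.
  by case: eqVneq => [->|//]; rewrite rI.
move=> g gK; have gK0 v : v \in C -> K0 <= g v by move=> /gK; lia.
rewrite (sE g setT gK0) ?inE // (sE g I gK0) // tE ?addrA //.
by move=> v; rewrite !inE => /andP[_ /gK]; lia.
Qed.

End Weights.

(** * Counting functions of subgraphs *)

Lemma imx_lap n (adj : rel 'I_n) (e : 'I_n -> int) (x : 'cV[rat]_n) v : irreflexive adj ->
  (imx adj e *m x) v 0 = - lap adj (fun v => - e v) (fun w => x w 0) v.
Proof.
move=> irr; rewrite mxE (bigD1 v) //= mxE eqxx /lap rmorphN /= mulNr opprB opprK addrC.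
congr (_ + _); rewrite [RHS]big_mkcond [RHS](bigD1 v) //= irr add0r.
apply: eq_bigr => w ne_wv; rewrite mxE eq_sym (negPf ne_wv).
by case: (adj v w); rewrite ?mul1r ?mul0r.
Qed.

Lemma neg_def_qpos n (adj : rel 'I_n) (e : 'I_n -> int) : irreflexive adj ->
  neg_def (imx adj e) -> qpos adj (fun v => - e v).
Proof.
move=> irr nd x [v xv]; pose X : 'cV[rat]_n := \col_w x w.
have X0 : X != 0.
  by apply: contraNneq xv => /(congr1 (fun M : 'cV[rat]_n => M v 0)); rewrite !mxE => ->.
have XE : (fun w => X w 0) = x by apply: functional_extensionality => w; rewrite mxE.
have := nd X X0; rewrite -mulmxA mxE -oppr_gt0 -sumrN; congr (0 < _).
by apply: eq_bigr => w _; rewrite imx_lap // XE !mxE mulrN opprK.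
Qed.

Lemma imx_unit n (adj : rel 'I_n) (e : 'I_n -> int) : symmetric adj -> irreflexive adj ->
  qpos adj (fun v => - e v) -> imx adj e \in unitmx.
Proof.
move=> sym irr pos; rewrite unitmxE unitfE; apply/negP => /det0P[x x0 xM].
have Mt : (imx adj e)^T = imx adj e.
  by apply/matrixP => i j; rewrite !mxE eq_sym sym; case: eqVneq => // ->.
have Mx : imx adj e *m x^T = 0 by rewrite -Mt -trmx_mul xM trmx0.
have : 0 < \sum_v x 0 v * lap adj (fun v => - e v) (x 0) v.
  apply: pos; apply/existsP; apply: contraNT x0 => /existsPn x0.
  by apply/eqP/rowP => v; rewrite mxE; apply/eqP; have := x0 v; rewrite negbK.
rewrite big1 ?ltxx // => v _; have := imx_lap e x^T v irr; rewrite Mx mxE.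
have -> : (fun w => x^T w 0) = x 0 by apply: functional_extensionality => w; rewrite mxE.
by move/eqP; rewrite eq_sym oppr_eq0 => /eqP->; rewrite mulr0.
Qed.

Section Embedding.
Variables (m n : nat) (adj : rel 'I_n) (e : 'I_n -> int) (phi : 'I_m -> 'I_n).
Hypotheses (adj_sym : symmetric adj) (adj_irr : irreflexive adj) (phi_inj : injective phi).
Let b v := - e v.
Let C := phi @: setT.
Let adj' : rel 'I_m := fun i j => adj (phi i) (phi j).
Let e' i := e (phi i).
Hypotheses (lap_pos : qpos adj b) (treeC : utree adj C).

Lemma sum_embed (V : zmodType) (F : 'I_n -> V) :
  (forall w, w \notin C -> F w = 0) -> \sum_w F w = \sum_i F (phi i).
Proof.
move=> F0; rewrite (bigID (mem C)) /= [X in _ + X]big1 ?addr0; last by move=> w /F0.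
rewrite big_imset /=; last by move=> i j _ _; apply: phi_inj.
by apply: eq_bigl => i; rewrite inE.
Qed.

Definition extend (V : nmodType) (f : 'I_m -> V) v : V :=
  if [pick i | phi i == v] is Some i then f i else 0.

Lemma extendE (V : nmodType) (f : 'I_m -> V) i : extend f (phi i) = f i.
Proof.
by rewrite /extend; case: pickP => [j /eqP/phi_inj->//|/(_ i)]; rewrite eqxx.
Qed.

Lemma extend_off (V : nmodType) (f : 'I_m -> V) v : v \notin C -> extend f v = 0.
Proof.
rewrite /extend; case: pickP => // i /eqP <-; by rewrite imset_f ?inE.
Qed.

Lemma lap_embed (x : 'I_n -> rat) i : (forall w, w \notin C -> x w = 0) ->
  lap adj b x (phi i) = lap adj' (fun i => - e' i) (fun i => x (phi i)) i.
Proof.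
move=> x0; rewrite /lap; congr (_ - _); rewrite big_mkcond sum_embed /= => [|w /x0->].
  by rewrite -big_mkcond.
by rewrite if_same.
Qed.

Lemma qpos_embed : qpos adj' (fun i => - e' i).
Proof.
move=> x [i xi]; have := lap_pos (x := extend x).
rewrite sum_embed => [|w wC]; last by rewrite extend_off // mul0r.
rewrite (eq_bigr (fun i => x i * lap adj' (fun i => - e' i) x i)); last first.
  move=> j _; rewrite extendE lap_embed => [|w]; last exact: extend_off.
  by congr (_ * lap _ _ _ _); apply: functional_extensionality => k; rewrite extendE.
by apply; exists (phi i); rewrite extendE.
Qed.

Lemma imx_embed_unit : imx adj' e' \in unitmx.
Proof.
apply: imx_unit; [by move=> i j; apply: adj_sym|by move=> i; apply: adj_irr|].
exact: qpos_embed.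
Qed.

Variables (a0 : {ffun 'I_n -> int}) (a0' : {ffun 'I_m -> int}) (J : {set 'I_n}) (J' : {set 'I_m}).
Hypotheses (a0E : forall i, a0' i = a0 (phi i)) (JE : forall i, (i \in J') = (phi i \in J)).

Let toEstar (y : {ffun 'I_n -> int}) : {ffun 'I_m -> int} := [ffun i => arg adj b a0 y (phi i)].

Lemma col_toEstar (y : {ffun 'I_n -> int}) : supp C y ->
  \col_i ((toEstar y i)%:~R : rat) =
  \col_i ((a0' i)%:~R : rat) - imx adj' e' *m \col_i (y (phi i))%:~R.
Proof.
move=> /suppP sy; apply/colP => i; rewrite mxE ffunE argE [RHS]mxE [X in _ = _ + X]mxE.
rewrite imx_lap; last by move=> j; apply: adj_irr.
rewrite opprK mxE a0E; congr (_ + _); rewrite lap_embed => [|w /sy->//].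
by congr lap; apply: functional_extensionality => j; rewrite mxE.
Qed.

Lemma ecoord_toEstar (y : {ffun 'I_n -> int}) : supp C y ->
  ecoord adj' e' (toEstar y) - ecoord adj' e' a0' = \col_i (y (phi i))%:~R.
Proof.
move=> sy; rewrite /ecoord (col_toEstar sy) mulmxBr mulKmx ?imx_embed_unit //.
by rewrite opprB opprK subrK.
Qed.

Lemma zcoefE (a : {ffun 'I_m -> int}) :
  zcoef adj' a = \prod_i ser ((valency adj' i)%:Z - 2) (a i).
Proof.
rewrite /zcoef; case: ifPn => [/forallP a_ge0|/forallPn[i ai]].
  by apply: eq_bigr => i _; rewrite /ser a_ge0.
by rewrite (bigD1 i) //= /ser (negPf ai) mul0r.
Qed.

Lemma valency_embed i : valency adj' i = deg adj C (phi i).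
Proof.
rewrite /valency /deg -(card_imset _ phi_inj); apply: eq_card => w; rewrite !inE.
apply/imsetP/andP => [[j + ->]|[/imsetP[j _ ->] ij]].
  by rewrite inE => ij; rewrite imset_f ?inE.
by exists j; rewrite ?inE.
Qed.

(** The difference of E-coordinates is [y] itself, so the class condition holds by integrality and
    the order condition on [J'] becomes a sign condition on [y]. *)
Lemma Qterm_toEstar (y : {ffun 'I_n -> int}) : supp C y ->
  Qterm adj' e' J' a0' (toEstar y) = if ~~ nonneg J y then wt adj b C a0 y else 0.
Proof.
move=> sy; have E i : ecoord adj' e' (toEstar y) i 0 - ecoord adj' e' a0' i 0 = (y (phi i))%:~R.
  have := congr1 (fun M : 'cV[rat]_m => M i 0) (ecoord_toEstar sy).
  have subE (A B : 'cV[rat]_m) : (A - B) i 0 = A i 0 - B i 0 by rewrite !mxE.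
  by rewrite /= subE [RHS]mxE.
rewrite /Qterm; have -> : sameclass adj' e' (toEstar y) a0'.
  by apply/forallP => i; rewrite ecoord_toEstar // mxE intr_int.
have -> : [forall v in J', ecoord adj' e' a0' v 0 <= ecoord adj' e' (toEstar y) v 0] =
    nonneg J y.
  apply/forall_inP/nonnegP => [H v vJ|H i].
    case: (boolP (v \in C)) => [/imsetP[i _ vi]|vC]; last by move/suppP: sy => ->.
    by move: vJ; rewrite vi -JE => /H; rewrite -subr_ge0 E ler0z.
  by rewrite JE -subr_ge0 E ler0z => /H.
rewrite /=; case: nonneg => //=; rewrite zcoefE /wt sy big_imset /=; last first.
  by move=> i j _ _; apply: phi_inj.
apply: eq_big => [i|i _]; first by rewrite inE.
by rewrite ffunE valency_embed.
Qed.

(** Elements of the class of [a0'] correspond to their integral differences from [a0'], that is, to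
    vectors supported on [C]. *)
Lemma has_fsum_Qterm : has_fsum (Qterm adj' e' J' a0') (Q adj b C J a0).
Proof.
(* The floor only serves to land in [int]: on the support of [Qterm] these differences are
   integers. *)
pose y' (a : {ffun 'I_m -> int}) i := Num.floor ((ecoord adj' e' a - ecoord adj' e' a0') i 0).
pose fromEstar (a : {ffun 'I_m -> int}) : {ffun 'I_n -> int} := [ffun v => extend (y' a) v].
have fin := finc_neg adj_sym adj_irr lap_pos J treeC.
apply: (has_fsum_reindex (h := toEstar) (h' := fromEstar) _ _
  (has_fsum_fsum (wsum_fsupp a0 fin))) => [y|a Qa].
  case: (boolP (supp C y)) => [sy _|sy]; last by rewrite /wt (negPf sy) if_same eqxx.
  split; last exact: Qterm_toEstar.
  apply/ffunP => v; rewrite ffunE; case: (boolP (v \in C)) => [/imsetP[i _ ->]|vC].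
    by rewrite extendE /y' ecoord_toEstar // mxE intrKfloor.
  by rewrite extend_off //; move/suppP: sy => ->.
have sy : supp C (fromEstar a) by apply/suppP => v vC; rewrite ffunE extend_off.
suff ya : toEstar (fromEstar a) = a by split=> //; rewrite -(Qterm_toEstar sy) ya.
have aclass : sameclass adj' e' a a0'.
  by move: Qa; rewrite /Qterm; case: sameclass => //=; rewrite eqxx.
have yE : \col_i (fromEstar a (phi i))%:~R = ecoord adj' e' a - ecoord adj' e' a0'.
  apply/colP => i; rewrite mxE ffunE extendE /y'.
  by move/forallP: aclass => /(_ i); rewrite intrEfloor => /eqP.
have := col_toEstar sy; rewrite yE /ecoord opprK mulmxDr mulmxN !mulKVmx ?imx_embed_unit //.
rewrite opprD opprK addrCA subrr addr0 => /colP H; apply/ffunP => i.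
by have := H i; rewrite !mxE => /intr_inj.
Qed.

End Embedding.

Theorem theorem3p3 (n : nat) (adj : rel 'I_n) (e : 'I_n -> int)
  (I : {set 'I_n}) (h : {ffun 'I_n -> int}) :
  is_tree adj -> neg_def (imx adj e) -> I != set0 ->
  exists N : int, forall a0 : {ffun 'I_n -> int},
    sameclass adj e a0 h -> (forall v, N <= a0 v) ->
    exists (s1 s2 : rat) (s3 : {set 'I_n} -> rat),
      [/\ has_fsum (Qterm adj e setT a0) s1,
          has_fsum (Qterm adj e I a0) s2,
          (forall C, C \in comps adj I ->
             has_fsum (Qterm (sub_adj adj C) (sub_e e C) setT (jstar C a0)) (s3 C)) &
          s1 = s2 + \sum_(C in comps adj I) s3 C].
Proof.
move=> tree nd /set0Pn[r rI].
have [sym irr' _ _] := tree; have irr : irreflexive adj by move=> v; apply/negbTE.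
have pos := neg_def_qpos irr nd.
have tT : utree adj setT by apply: is_tree_utree => //; apply: leq_ltn_trans (ltn_ord r).
have [K [s [cs sE]]] := remove_set sym irr pos I tT; rewrite setTD in cs.
exists K => a0 _ a0K; pose q C J := Q adj (fun v => - e v) C J a0.
exists (q setT setT), (q setT I), (fun C => q C setT).
(* The whole graph is embedded by the identity, a component further down by [enum_val]. *)
have full J : has_fsum (Qterm adj e J a0) (q setT J).
  have idT : id @: [set: 'I_n] = setT by apply/setP => v; rewrite imset_id.
  have := @has_fsum_Qterm n n adj e id sym irr (fun _ _ => id) pos; rewrite idT.
  exact.
split=> //.
- move=> C; rewrite (compsE sym cs) => Cs; have tC := comps_of_utree cs Cs.
  have CE : enum_val @: [set: 'I_#|C|] = C.
    apply/setP => v; apply/imsetP/idP => [[i _ ->]|vC]; first exact: enum_valP.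
    by exists (enum_rank_in vC v); rewrite ?inE ?enum_rankK_in.
  have := @has_fsum_Qterm #|C| n adj e enum_val sym irr enum_val_inj pos; rewrite CE.
  by apply=> // i; rewrite ?ffunE ?inE.
rewrite /q sE //; congr (_ + _); rewrite -big_enum; apply: perm_big; apply: uniq_perm.
- exact: comps_of_uniq cs.
- exact: enum_uniq.
by move=> C; rewrite mem_enum (compsE sym cs).
Qed.
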